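(* Let $\mathrm L$ be a spline-admissible operator with null space $\mathcal N_{\mathrm L}$ and pseudoinverse $\mathrm L^\dagger$, and let $p\in[1,\infty]$. Then the native space $\mathcal M_{\mathrm L}(\mathbb T^d)=\{f\in\mathcal S'(\mathbb T^d):\mathrm Lf\in\mathcal M(\mathbb T^d)\}$ is the direct sum $\mathcal M_{\mathrm L}(\mathbb T^d)=\mathrm L^\dagger(\mathcal M(\mathbb T^d))\oplus\mathcal N_{\mathrm L}$, where $\mathrm L^\dagger(\mathcal M(\mathbb T^d))=\{\mathrm L^\dagger w:w\in\mathcal M(\mathbb T^d)\}$. It is a Banach space for the norm $\|f\|_{\mathcal M_{\mathrm L},p}=\big(\|\mathrm Lf\|_{\mathcal M}^p+\|\mathrm{Proj}_{\mathcal N_{\mathrm L}}f\|_2^p\big)^{1/p}$ (maximum for $p=\infty$), and these norms are equivalent for all $p\in[1,\infty]$. Moreover $\mathcal S(\mathbb T^d)\subseteq\mathcal M_{\mathrm L}(\mathbb T^d)\subseteq\mathcal S'(\mathbb T^d)$ with continuous embeddings, $\mathrm L$ is continuous from $\mathcal M_{\mathrm L}(\mathbb T^d)$ to $\mathcal M(\mathbb T^d)$, and every periodic $\mathrm L$-spline belongs to $\mathcal M_{\mathrm L}(\mathbb T^d)$.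
   Context: Let $d\ge1$, $\mathbb T^d=\mathbb R^d/2\pi\mathbb Z^d$, $\mathcal S(\mathbb T^d)$ the smooth periodic functions (Fréchet topology) and $\mathcal S'(\mathbb T^d)$ its dual; for $f\in L_1$, $\langle f,\varphi\rangle=(2\pi)^{-d}\int_{\mathbb T^d}f\varphi$. With $e_{\bm k}(\bm x)=e^{\mathrm i\langle\bm x,\bm k\rangle}$, each $f\in\mathcal S'$ expands uniquely as $f=\sum\widehat f[\bm k]e_{\bm k}$ with slowly growing coefficients. Operators in $\mathcal L_{\mathrm{SI}}(\mathcal S'(\mathbb T^d))$ (linear, shift-invariant, continuous on $\mathcal S'$) act by $\mathrm Lf=\sum\widehat L[\bm k]\widehat f[\bm k]e_{\bm k}$ with slowly growing $\widehat L$. $\mathrm L$ is spline-admissible if its null space $\mathcal N_{\mathrm L}$ is finite-dimensional and it admits a pseudoinverse $\mathrm L^\dagger\in\mathcal L_{\mathrm{SI}}$ ($\mathrm L\mathrm L^\dagger\mathrm L=\mathrm L$, $\mathrm L^\dagger\mathrm L\mathrm L^\dagger=\mathrm L^\dagger$, $\mathrm L\mathrm L^\dagger$ and $\mathrm L^\dagger\mathrm L$ self-adjoint); then $N_{\mathrm L}=\{\bm k:\widehat L[\bm k]=0\}=\{\bm k_1,\dots,\bm k_{N_0}\}$ is finite, $\mathcal N_{\mathrm L}=\mathrm{Span}\{e_{\bm k_n}\}$, $\mathrm L^\dagger$ has Fourier sequence $1/\widehat L[\bm k]$ off $N_{\mathrm L}$ and $0$ on it, and $\mathrm{Proj}_{\mathcal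 N_{\mathrm L}}f:=\sum_{n=1}^{N_0}\widehat f[\bm k_n]e_{\bm k_n}$. $\|\cdot\|_2$ is the $L_2$ norm for the normalized measure, so $\|p\|_2^2=\sum|\widehat p[\bm k]|^2$. $\mathcal C(\mathbb T^d)$ is the space of continuous periodic functions with $\|\cdot\|_\infty$; $\mathcal M(\mathbb T^d)=\mathcal C(\mathbb T^d)'$ is the space of periodic finite Radon measures with total variation norm, identified with $\{w\in\mathcal S'(\mathbb T^d):\|w\|_{\mathcal M}:=\sup_{\varphi\in\mathcal S,\|\varphi\|_\infty=1}\langle w,\varphi\rangle<\infty\}$. The Dirac comb $Ш$ is given by $\langle Ш,\varphi\rangle=\varphi(\bm 0)$. A periodic $\mathrm L$-spline is an $f\in\mathcal S'(\mathbb T^d)$ with $\mathrm Lf=\sum_{k=1}^Ka_kШ(\cdot-\bm x_k)$ for some $K\ge0$, distinct $\bm x_k\in\mathbb T^d$ and $a_k\in\mathbb R\setminus\{0\}$. *)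

(* Defs.v *)
From HB Require Import structures.
From mathcomp Require Import all_boot all_order all_algebra.
From mathcomp Require Import complex.
From mathcomp Require Import all_classical all_reals all_analysis.
Set Implicit Arguments. Unset Strict Implicit. Unset Printing Implicit Defensive.
Import Order.TTheory GRing.Theory Num.Theory.
Local Open Scope ring_scope.
Local Open Scope classical_set_scope.

(* Model.  A periodic distribution f in S'(T^d) is represented by its  *)
(* (unique) Fourier sequence  k |-> f^[k]  on Z^d = 'rV[int]_d, which  *)
(* must be slowly growing.  A test function phi in S(T^d) is likewise  *)
(* represented by its Fourier sequence, which is rapidly decaying.     *)
(* A point of T^d is represented by x : 'I_d -> R (mod 2 pi).          *)

Definition Zd (d : nat) := 'rV[int]_d.

Definition knorm (R : realType) (d : nat) (k : Zd d) : R :=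
  \sum_(i < d) (`|k 0 i|%R)%:~R.

Definition cmod (R : realType) (c : R[i]) : R := Normc.normc c.

Definition fseq (R : realType) (d : nat) := Zd d -> R[i].

Definition slowly_growing (R : realType) (d : nat) (f : fseq R d) : Prop :=
  exists (C : R) (n : nat), forall k, cmod (f k) <= C * (1 + knorm R k) ^+ n.

(* Fourier sequences of the elements of S(T^d) *)
Definition rapidly_decaying (R : realType) (d : nat) (phi : fseq R d) : Prop :=
  forall n : nat, exists C : R, forall k, cmod (phi k) * (1 + knorm R k) ^+ n <= C.

(* the defining seminorms of S(T^d), in Fourier form *)
Definition Sseminorm (R : realType) (d : nat) (n : nat) (phi : fseq R d) : R :=
  sup (range (fun k => cmod (phi k) * (1 + knorm R k) ^+ n)).

(* box {k : |k_i| <= N} of Z^d, enumerated by the finite type of ffuns *)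
Definition boxpt (d N : nat) (j : {ffun 'I_d -> 'I_(N.*2.+1)}) : Zd d :=
  \row_(i < d) ((nat_of_ord (j i))%:Z - N%:Z).

Definition phase (R : realType) (d : nat) (x : 'I_d -> R) (k : Zd d) : R :=
  \sum_(i < d) x i * (k 0 i)%:~R.
Definition expi (R : realType) (t : R) : R[i] := (cos t +i* sin t)%C.

Definition partial_eval (R : realType) (d : nat) (phi : fseq R d) (x : 'I_d -> R)
  (N : nat) : R[i] :=
  \sum_(j : {ffun 'I_d -> 'I_(N.*2.+1)}) phi (boxpt j) * expi (phase x (boxpt j)).

(* ||phi||_oo <= 1, i.e. |phi(x)| <= 1 for all x, phi(x) being the    *)
(* limit of the (absolutely convergent) Fourier series                  *)
Definition supnorm_le1 (R : realType) (d : nat) (phi : fseq R d) : Prop :=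
  forall (x : 'I_d -> R) (eps : R), 0 < eps ->
    exists N0 : nat, forall N, (N0 <= N)%N -> cmod (partial_eval phi x N) <= 1 + eps.

(* <f, phi> = (2pi)^-d \int f phi = sum_k f^[k] phi^[-k] = c *)
Definition pairing_to (R : realType) (d : nat) (f phi : fseq R d) (c : R[i]) : Prop :=
  forall eps : R, 0 < eps -> exists N0 : nat, forall N, (N0 <= N)%N ->
    cmod ((\sum_(j : {ffun 'I_d -> 'I_(N.*2.+1)}) f (boxpt j) * phi (- boxpt j)) - c)
      <= eps.

Definition in_M (R : realType) (d : nat) (w : fseq R d) : Prop :=
  slowly_growing w /\
  exists B : R, forall (phi : fseq R d) (c : R[i]),
    rapidly_decaying phi -> supnorm_le1 phi -> pairing_to w phi c -> cmod c <= B.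

Definition normM (R : realType) (d : nat) (w : fseq R d) : R :=
  sup [set r : R | exists (phi : fseq R d) (c : R[i]),
         [/\ rapidly_decaying phi, supnorm_le1 phi, pairing_to w phi c & r = cmod c]].

(* LSI operators are Fourier multipliers *)
Definition app (R : realType) (d : nat) (m : fseq R d) (f : fseq R d) : fseq R d :=
  fun k => m k * f k.

Definition fzero (R : realType) (d : nat) : fseq R d := fun _ => 0.

Definition in_null (R : realType) (d : nat) (Lh f : fseq R d) : Prop :=
  slowly_growing f /\ app Lh f = @fzero R d.

Definition in_span (R : realType) (d : nat) (s : seq (fseq R d)) (f : fseq R d) : Prop :=
  exists c : 'I_(size s) -> R[i],
    f = fun k => \sum_(i < size s) c i * nth (@fzero R d) s i k.

(* Moore-Penrose pseudoinverse in L_SI (adjoint = Hermitian adjoint,   *)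
(* whose multiplier is the complex conjugate)                           *)
Definition is_pinv (R : realType) (d : nat) (Lh Ld : fseq R d) : Prop :=
  [/\ slowly_growing Ld,
      forall k, Lh k * Ld k * Lh k = Lh k,
      forall k, Ld k * Lh k * Ld k = Ld k,
      forall k, conjc (Lh k * Ld k) = Lh k * Ld k
    & forall k, conjc (Ld k * Lh k) = Ld k * Lh k].

Definition spline_admissible (R : realType) (d : nat) (Lh : fseq R d) : Prop :=
  [/\ slowly_growing Lh,
      (exists s : seq (fseq R d), forall f, in_null Lh f <-> in_span s f)
    & exists Ld, is_pinv Lh Ld].

Definition projN_norm2 (R : realType) (d : nat) (Lh f : fseq R d) : R :=
  Num.sqrt (\sum_(k \in [set k | Lh k = 0]) cmod (f k) ^+ 2).

Definition in_ML (R : realType) (d : nat) (Lh f : fseq R d) : Prop :=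
  slowly_growing f /\ in_M (app Lh f).

Definition normML (R : realType) (d : nat) (p : \bar R) (Lh f : fseq R d) : R :=
  let a := normM (app Lh f) in
  let b := projN_norm2 Lh f in
  match p with
  | EFin r => powR (powR a r + powR b r) r^-1
  | _ => Num.max a b
  end.

(* shifted Dirac comb Sha(. - x0): <Sha(.-x0), phi> = phi(x0) *)
Definition dirac_at (R : realType) (d : nat) (x0 : 'I_d -> R) : fseq R d :=
  fun m => expi (- phase x0 m).

Definition same_torus_point (R : realType) (d : nat) (x y : 'I_d -> R) : Prop :=
  forall i, exists z : int, x i - y i = z%:~R * (2 * pi).

Definition is_Lspline (R : realType) (d : nat) (Lh f : fseq R d) : Prop :=
  slowly_growing f /\
  exists (K : nat) (a : 'I_K -> R) (x : 'I_K -> 'I_d -> R),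
    [/\ forall j, a j != 0,
        forall j l, j != l -> ~ same_torus_point (x j) (x l)
      & app Lh f = fun m => \sum_(j < K) ((a j)%:C)%C * dirac_at (x j) m].

(* Main.v *)
(** Everything happens on Fourier coefficients.  A test function [phi] with
    sup-norm at most 1 has coefficients bounded by 1 (average [phi] against an
    exponential over a fine grid of the torus), so a rapidly decaying sequence is
    a measure whose norm is at most its l^1 norm; conversely, testing against
    exponentials gives [|w k| <= ||w||_M].  The null set of [L] is finite because
    the exponentials it carries are linearly independent; hence [L Ld w] and [w]
    differ by a trigonometric polynomial, which gives the direct sum.  Since
    [|f k| <= (|Ld k| + 1) ||f||], the space embeds in S', and a Cauchy sequence
    converges coefficientwise, with [L u_n] converging uniformly in [k]; passing to
    the limit in the pairings yields completeness. *)

Require Import Defs.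
From HB Require Import structures.
From mathcomp Require Import all_boot all_order all_algebra.
From mathcomp Require Import complex.
From mathcomp Require Import all_classical all_reals all_analysis.
From mathcomp Require Import ring lra zify.
Import Order.TTheory GRing.Theory Num.Theory.
Import numFieldNormedType.Exports.
Local Open Scope ring_scope.
Local Open Scope classical_set_scope.

Set Implicit Arguments.
Unset Strict Implicit.
Unset Printing Implicit Defensive.

(** * Complex moduli and limits *)

Section Modulus.
Variable R : realType.
Implicit Types x y : R[i].

Lemma cmod_ge0 x : 0 <= cmod x.
Proof. by case: x => a b; exact: sqrtr_ge0. Qed.

Lemma cmod0 : cmod (0 : R[i]) = 0.
Proof. exact: Normc.normc0. Qed.

Lemma cmod1 : cmod (1 : R[i]) = 1.
Proof. exact: Normc.normc1. Qed.

Lemma cmodM x y : cmod (x * y) = cmod x * cmod y.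
Proof. exact: Normc.normcM. Qed.

Lemma cmodD x y : cmod (x + y) <= cmod x + cmod y.
Proof. exact: le_normcD. Qed.

Lemma cmodN x : cmod (- x) = cmod x.
Proof. exact: normcN. Qed.

Lemma cmodC x y : cmod (x - y) = cmod (y - x).
Proof. by rewrite -cmodN opprB. Qed.

Lemma cmod_eq0 x : cmod x = 0 -> x = 0.
Proof. exact: Normc.eq0_normc. Qed.

Lemma cmod_real (a : R) : cmod (a%:C)%C = `|a|.
Proof. by rewrite /cmod /= expr0n addr0 sqrtr_sqr. Qed.

Lemma cmod_nat n : cmod (n%:R : R[i]) = n%:R.
Proof.
rewrite -(rmorph_nat (real_complex R)); apply: etrans (cmod_real _) _.
by rewrite ger0_norm.
Qed.

Lemma cmodX x n : cmod (x ^+ n) = cmod x ^+ n.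
Proof. by elim: n => [|n IH]; rewrite ?expr0 ?cmod1// !exprS cmodM IH. Qed.

Lemma cmod_tri z x y : cmod (x - y) <= cmod (x - z) + cmod (z - y).
Proof. by have := cmodD (x - z) (z - y); rewrite addrA subrK. Qed.

Lemma cmod_sub_le x y : cmod x <= cmod (x - y) + cmod y.
Proof. by have := cmodD (x - y) y; rewrite subrK. Qed.

Lemma cmod_sum (I : Type) (s : seq I) (P : pred I) (F : I -> R[i]) :
  cmod (\sum_(i <- s | P i) F i) <= \sum_(i <- s | P i) cmod (F i).
Proof.
elim/big_rec2: _ => [|i y x _ le_xy]; first by rewrite cmod0.
by apply: le_trans (cmodD _ _) _; rewrite lerD2l.
Qed.

Lemma cmod_le_ReIm x : cmod x <= `|complex.Re x| + `|complex.Im x|.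
Proof.
case: x => a b; rewrite /cmod /= -[leRHS]ger0_norm ?addr_ge0// -sqrtr_sqr.
apply: ler_wsqrtr; rewrite sqrrD !real_normK ?num_real// -addrA lerD2l.
by rewrite lerDr mulrn_wge0// mulr_ge0.
Qed.

Lemma Re_le_cmod x : `|complex.Re x| <= cmod x.
Proof.
case: x => a b; rewrite /cmod /= -sqrtr_sqr.
by apply: ler_wsqrtr; rewrite lerDl sqr_ge0.
Qed.

Lemma Im_le_cmod x : `|complex.Im x| <= cmod x.
Proof.
case: x => a b; rewrite /cmod /= -sqrtr_sqr.
by apply: ler_wsqrtr; rewrite lerDr sqr_ge0.
Qed.

End Modulus.

Section Limits.
Variable R : realType.
Implicit Types (u v : nat -> R[i]) (b c : R[i]).

(** Phrased with [cmod] and a weak inequality, exactly as in [pairing_to], so that pairings are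
    limits of box sums and no topology on [R[i]] is involved. *)
Definition climit u c := forall eps : R, 0 < eps ->
  exists N0 : nat, forall N, (N0 <= N)%N -> cmod (u N - c) <= eps.

Lemma climit_unique {u b c} : climit u b -> climit u c -> b = c.
Proof.
move=> ub uc; apply/eqP; rewrite -subr_eq0; apply/eqP/cmod_eq0/eqP.
rewrite eq_le cmod_ge0 andbT; apply/ler_addgt0Pr => e e0; rewrite add0r.
have e2 : 0 < e / 2 by rewrite divr_gt0.
have [N1 h1] := ub _ e2; have [N2 h2] := uc _ e2.
apply: le_trans (cmod_tri (u (maxn N1 N2)) b c) _.
rewrite (cmodC b) [leRHS]splitr lerD//.
- by apply: h1; rewrite leq_maxl.
- by apply: h2; rewrite leq_maxr.
Qed.

Lemma climitD {u v b c} : climit u b -> climit v c ->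
  climit (fun n => u n + v n) (b + c).
Proof.
move=> ub vc e e0.
have e2 : 0 < e / 2 by rewrite divr_gt0.
have [N1 h1] := ub _ e2; have [N2 h2] := vc _ e2.
exists (maxn N1 N2) => N; rewrite geq_max => /andP[N1N N2N].
rewrite opprD addrACA; apply: le_trans (cmodD _ _) _.
by rewrite [leRHS]splitr lerD// ?h1// h2.
Qed.

Lemma climitZ a {u c} : climit u c -> climit (fun n => a * u n) (a * c).
Proof.
move=> uc e e0; have a0 : 0 < cmod a + 1 by rewrite ltr_wpDl// cmod_ge0.
have [N1 h1] := uc _ (divr_gt0 e0 a0); exists N1 => N /h1 h.
rewrite -mulrBr cmodM; apply: le_trans (_ : (cmod a + 1) * (e / (cmod a + 1)) <= e).
  by apply: ler_pM; rewrite ?cmod_ge0// lerDl.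
by rewrite mulrC divfK// gt_eqF.
Qed.

Lemma climit_le {u c} {B : R} :
  climit u c -> (exists N0, forall N, (N0 <= N)%N -> cmod (u N) <= B) -> cmod c <= B.
Proof.
move=> uc [N0 uB]; apply/ler_addgt0Pr => e e0.
have [N1 h1] := uc _ e0.
apply: le_trans (cmod_sub_le c (u (maxn N0 N1))) _.
by rewrite addrC lerD ?uB ?leq_maxl// cmodC h1// leq_maxr.
Qed.

Lemma eq_climit {u} v {c} : (exists N0, forall N, (N0 <= N)%N -> u N = v N) ->
  climit v c -> climit u c.
Proof.
move=> [N0 uv] vc e e0; have [N1 h1] := vc _ e0.
exists (maxn N0 N1) => N; rewrite geq_max => /andP[N0N N1N].
by rewrite uv// h1.
Qed.

Lemma climit_cst c : climit (fun=> c) c.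
Proof. by move=> e e0; exists 0%N => N _; rewrite subrr cmod0 ltW. Qed.

Lemma real_cauchy_limit (u : nat -> R) :
  (forall e, 0 < e -> exists N0, forall m n, (N0 <= m)%N -> (N0 <= n)%N ->
     `|u m - u n| <= e) ->
  exists l, forall e, 0 < e -> exists N0, forall n, (N0 <= n)%N -> `|u n - l| <= e.
Proof.
move=> cu; have : cvg (u @ \oo).
  apply/cauchy_cvgP/cauchy_exP => e e0.
  have [N0 h] := cu _ (divr_gt0 e0 (ltr0n R 2)); exists (u N0).
  exists N0 => // n /= N0n; rewrite /ball /=.
  apply: le_lt_trans (h _ _ (leqnn _) N0n) _.
  by rewrite ltr_pdivrMr// mulr_natr mulr2n ltrDl.
move=> /cvgrPdist_le ul; exists (lim (u @ \oo)) => e e0.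
have [N0 _ h] := ul _ e0; exists N0 => n N0n.
by rewrite distrC; exact: h.
Qed.

Lemma cauchy_climit u :
  (forall e, 0 < e -> exists N0, forall m n, (N0 <= m)%N -> (N0 <= n)%N ->
     cmod (u m - u n) <= e) ->
  exists c, climit u c.
Proof.
move=> cu.
have [|a ha] := @real_cauchy_limit (fun n => complex.Re (u n)).
  move=> e /cu[N0 h]; exists N0 => m n mN nN; apply: le_trans (h _ _ mN nN).
  by apply: le_trans (Re_le_cmod _); case: (u m) (u n) => [? ?] [? ?].
have [|b hb] := @real_cauchy_limit (fun n => complex.Im (u n)).
  move=> e /cu[N0 h]; exists N0 => m n mN nN; apply: le_trans (h _ _ mN nN).
  by apply: le_trans (Im_le_cmod _); case: (u m) (u n) => [? ?] [? ?].
exists (a +i* b)%C => e e0.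
have e2 : 0 < e / 2 by rewrite divr_gt0.
have [N1 h1] := ha _ e2; have [N2 h2] := hb _ e2.
exists (maxn N1 N2) => N; rewrite geq_max => /andP[/h1 {}h1 /h2 {}h2].
apply: le_trans (cmod_le_ReIm _) _; rewrite [leRHS]splitr.
by move: h1 h2; case: (u N) => x y /= h1 h2; exact: lerD.
Qed.

End Limits.

(** * Sums over boxes of Z^d *)

Section Boxes.
Variable d : nat.

(** A duplicate-free list of frequencies, which can be filtered and permuted, in place of sums
    indexed by finite functions. *)
Definition box (N : nat) : seq (Zd d) :=
  [seq boxpt j | j <- enum {ffun 'I_d -> 'I_(N.*2.+1)}].

Lemma boxpt_inj N : injective (@boxpt d N).
Proof.
move=> j l /rowP jl; apply/ffunP => i; apply/val_inj.
by have := jl i; rewrite !mxE => /addIr [].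
Qed.

Lemma box_uniq N : uniq (box N).
Proof. by rewrite map_inj_uniq ?enum_uniq//; exact: boxpt_inj. Qed.

Lemma mem_box N (k : Zd d) : (k \in box N) = [forall i, (`|k 0%R i| <= N)%N].
Proof.
apply/mapP/forallP => [[j _ ->] i|kN].
  by rewrite mxE; move: (ltn_ord (j i)); move: (nat_of_ord _) => m; lia.
exists [ffun i => inord `|k 0%R i + N%:Z|]; first by rewrite mem_enum.
by apply/rowP => i; rewrite mxE ffunE; move: (kN i); move: (k 0%R i) => z zN;
  rewrite inordK; lia.
Qed.

Lemma big_boxpt (V : nmodType) N (F : Zd d -> V) :
  \sum_(j : {ffun 'I_d -> 'I_(N.*2.+1)}) F (boxpt j) = \sum_(k <- box N) F k.
Proof. by rewrite /box big_map big_enum. Qed.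

Lemma mem_boxN N (k : Zd d) : (- k \in box N) = (k \in box N).
Proof. by rewrite !mem_box; apply: eq_forallb => i; rewrite mxE abszN. Qed.

Lemma big_boxN (V : nmodType) N (F : Zd d -> V) :
  \sum_(k <- box N) F (- k) = \sum_(k <- box N) F k.
Proof.
rewrite -[LHS](big_map -%R xpredT); apply: perm_big; apply: uniq_perm.
- by rewrite map_inj_uniq ?box_uniq//; exact: oppr_inj.
- exact: box_uniq.
- by move=> k; rewrite -[k in LHS]opprK mem_map ?mem_boxN//; exact: oppr_inj.
Qed.

Lemma sub_box N M (k : Zd d) : (N <= M)%N -> k \in box N -> k \in box M.
Proof.
by rewrite !mem_box => NM /forallP kN; apply/forallP => i; apply: leq_trans (kN i) NM.
Qed.

Lemma mem_box_large (s : seq (Zd d)) :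
  exists N0, forall N, (N0 <= N)%N -> {subset s <= box N}.
Proof.
exists (\max_(k <- s) \max_(i < d) `|k 0%R i|)%N => N sN k ks.
rewrite mem_box; apply/forallP => i; apply: leq_trans sN.
apply: leq_trans (@leq_bigmax_seq _ s xpredT
  (fun k : Zd d => \max_(i < d) `|k 0%R i|)%N k ks isT).
exact: (@leq_bigmax 'I_d (fun i => `|k 0%R i|%N) i).
Qed.

Lemma big_box_sub (V : nmodType) N M (F : Zd d -> V) : (N <= M)%N ->
  \sum_(k <- box M | k \in box N) F k = \sum_(k <- box N) F k.
Proof.
move=> NM; rewrite -big_filter; apply: perm_big; apply: uniq_perm.
- by rewrite filter_uniq// box_uniq.
- exact: box_uniq.
- move=> k; rewrite mem_filter; case: (boolP (k \in box N)) => //= kN.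
  exact: sub_box kN.
Qed.

Lemma big_boxB (V : zmodType) N M (F : Zd d -> V) : (N <= M)%N ->
  \sum_(k <- box M) F k - \sum_(k <- box N) F k
  = \sum_(k <- box M | k \notin box N) F k.
Proof.
move=> NM; rewrite (bigID [in box N])/= big_box_sub//.
by rewrite addrAC subrr add0r.
Qed.

Lemma big_box_supp (V : nmodType) N (s : seq (Zd d)) (F : Zd d -> V) :
  uniq s -> {subset s <= box N} -> (forall k, k \notin s -> F k = 0) ->
  \sum_(k <- box N) F k = \sum_(k <- s) F k.
Proof.
move=> us sN F0; rewrite (bigID [in s])/= [X in _ + X]big1 => [|k /F0//].
rewrite addr0 -big_filter; apply: perm_big; apply: uniq_perm => //.
  by rewrite filter_uniq// box_uniq.
move=> k; rewrite mem_filter; case: (boolP (k \in s)) => //= ks.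
exact: sN.
Qed.

End Boxes.

(** * Polynomial weights on Z^d and absolute summability *)

Section Weights.
Variables (R : realType) (d : nat).
Implicit Types k : Zd d.

Lemma knormE k : knorm R k = \sum_(i < d) (`|k 0%R i|%N)%:R.
Proof. by apply: eq_bigr => i _; rewrite -abszE pmulrn. Qed.

Lemma knorm_ge0 k : 0 <= knorm R k.
Proof. by rewrite knormE sumr_ge0. Qed.

Lemma knormN k : knorm R (- k) = knorm R k.
Proof. by rewrite !knormE; apply: eq_bigr => i _; rewrite mxE abszN. Qed.

Lemma kweight_ge1 k : 1 <= 1 + knorm R k.
Proof. by rewrite lerDl knorm_ge0. Qed.

Lemma kweight_gt0 k : 0 < 1 + knorm R k.
Proof. exact: lt_le_trans (kweight_ge1 k). Qed.

Lemma kweightX_gt0 k n : 0 < (1 + knorm R k) ^+ n.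
Proof. by rewrite exprn_gt0// kweight_gt0. Qed.

Let inv_sq (n : nat) : R := ((1 + n%:R) ^+ 2)^-1.

Let sum_inv_sq n : \sum_(0 <= l < n) inv_sq l <= 2.
Proof.
(* The induction needs the sharper telescoping bound 2 - 1/(m+1): the term added at each step
   satisfies 1/(m+2)^2 <= 1/(m+1) - 1/(m+2). *)
suff H m : \sum_(0 <= l < m.+1) inv_sq l <= 2 - (m.+1%:R)^-1.
  case: n => [|n]; first by rewrite big_geq.
  by apply: le_trans (H n) _; rewrite gerBl invr_ge0.
elim: m => [|m IH].
  by rewrite big_nat1 /inv_sq addr0 expr1n; lra.
rewrite big_nat_recr//=; apply: le_trans (lerD IH (lexx _)) _.
rewrite /inv_sq nat1r -[leLHS]addrA lerD2l.
rewrite -lerBDl -subr_ge0.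
have m1 : 0 < m.+1%:R :> R by [].
have m2 : 0 < m.+2%:R :> R by [].
suff -> : (- m.+2%:R^-1 - - m.+1%:R^-1 - (m.+2%:R ^+ 2)^-1 : R)
  = (m.+1%:R * m.+2%:R ^+ 2)^-1 by rewrite invr_ge0 mulr_ge0 ?exprn_ge0.
have -> : m.+2%:R = 1 + m.+1%:R :> R by rewrite nat1r.
by field; rewrite nat1r !lt0r_neq0.
Qed.

Let sum_inv_sq_sym N : \sum_(l < N.*2.+1) inv_sq `|(l%:Z - N%:Z)|%N <= 4.
Proof.
rewrite -(big_mkord xpredT (fun l => inv_sq `|(l%:Z - N%:Z)|%N)).
rewrite (big_cat_nat (n := N))//=; last by lia.
have -> : 4 = 2 + 2 :> R by lra.
apply: lerD.
  (* Read backwards, the negative half has terms [inv_sq l.+1], each at most [inv_sq l]. *)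
  rewrite big_nat_rev/= add0n; apply: le_trans (sum_inv_sq N).
  rewrite big_nat_cond [leRHS]big_nat_cond; apply: ler_sum => l /andP[/andP[_ lN] _].
  have -> : `|((N - l.+1)%:Z - N%:Z)|%N = l.+1 by lia.
  rewrite /inv_sq lef_pV2 ?posrE ?exprn_gt0 ?ltr_pwDl//.
  by rewrite lerXn2r ?nnegrE ?addr_ge0// lerD2l ler_nat.
rewrite -{1}[N]add0n big_addn; apply: le_trans (sum_inv_sq (N.*2.+1 - N)).
apply: ler_sum => l _; have -> // : `|((l + N)%:Z - N%:Z)|%N = l by lia.
Qed.

(** Since 1 + |k| dominates every 1 + |k_i|, the weight of order 2d dominates the product of the (1
    + |k_i|)^2. The sum over the box then factors into d one-dimensional sums, each at most 4. *)
Lemma kweight_sum N : \sum_(k <- box d N) ((1 + knorm R k) ^+ d.*2)^-1 <= 4 ^+ d.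
Proof.
rewrite -(big_boxpt N (fun k => ((1 + knorm R k) ^+ d.*2)^-1)).
apply: le_trans (_ : \prod_(i < d) \sum_(l < N.*2.+1) inv_sq `|(l%:Z - N%:Z)|%N <= _);
  last first.
  have -> : 4 ^+ d = \prod_(i < d) 4 :> R by rewrite prodr_const card_ord.
  by apply: ler_prod => i _; rewrite sum_inv_sq_sym sumr_ge0// => l _;
    rewrite invr_ge0 exprn_ge0// addr_ge0.
rewrite bigA_distr_bigA/=; apply: ler_sum => j _.
rewrite prodfV lef_pV2 ?posrE ?kweightX_gt0//; last first.
  by apply: prodr_gt0 => i _; rewrite exprn_gt0// ltr_pwDl.
have -> : (1 + knorm R (boxpt j)) ^+ d.*2
    = \prod_(i < d) (1 + knorm R (boxpt j)) ^+ 2.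
  by rewrite prodr_const card_ord -exprM mul2n.
apply: ler_prod => i _; rewrite exprn_ge0 ?addr_ge0//=.
rewrite lerXn2r ?nnegrE ?addr_ge0 ?knorm_ge0// lerD2l knormE (bigD1 i)//= mxE.
by rewrite lerDl sumr_ge0.
Qed.

(** Absolute summability over Z^d is expressed by a bound on box sums that is uniform in N; decay of
    order 2d suffices for it. *)
Lemma rapid_summable (F : Zd d -> R[i]) (C : R) :
  (forall k, cmod (F k) * (1 + knorm R k) ^+ d.*2 <= C) ->
  forall N, \sum_(k <- box d N) cmod (F k) <= C * 4 ^+ d.
Proof.
move=> FC N.
apply: le_trans (_ : C * \sum_(k <- box d N) ((1 + knorm R k) ^+ d.*2)^-1 <= _).
  rewrite mulr_sumr; apply: ler_sum => k _.
  by rewrite ler_pdivlMr ?kweightX_gt0.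
apply: ler_wpM2l (kweight_sum N).
by apply: le_trans (FC 0); rewrite mulr_ge0 ?cmod_ge0 ?ltW// kweightX_gt0.
Qed.

End Weights.

Section BoxSums.
Variables (R : realType) (d : nat).
Implicit Types F : Zd d -> R[i].

(** The box sums of moduli are nondecreasing and bounded; past a radius whose sum is within e of
    their supremum, what remains is at most e. *)
Lemma box_tail F (B e : R) : (forall N, \sum_(k <- box d N) cmod (F k) <= B) ->
  0 < e -> exists N0, forall N M, (N0 <= N)%N -> (N <= M)%N ->
    \sum_(k <- box d M | k \notin box d N) cmod (F k) <= e.
Proof.
set T := fun N => \sum_(k <- box d N) cmod (F k) => TB e0.
have supT : has_sup (range T).
  by split; [exists (T 0%N), 0%N | exists B; move=> _ [N _ <-]; exact: TB].
have [_ [N0 _ <-] N0e] := sup_adherent e0 supT.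
exists N0 => N M N0N NM.
rewrite -big_boxB// lerBlDr; apply: le_trans (sup_upper_bound supT _) _.
  by exists M.
apply/ltW; rewrite -ltrBlDl; apply: lt_le_trans N0e _.
rewrite /T -subr_ge0 big_boxB//.
by apply: sumr_ge0 => k _; rewrite cmod_ge0.
Qed.

Lemma box_sum_dist F N M : (N <= M)%N ->
  cmod (\sum_(k <- box d M) F k - \sum_(k <- box d N) F k)
  <= \sum_(k <- box d M | k \notin box d N) cmod (F k).
Proof. by move=> NM; rewrite big_boxB// cmod_sum. Qed.

Lemma box_sum_climit F (B : R) :
  (forall N, \sum_(k <- box d N) cmod (F k) <= B) ->
  exists2 c, climit (fun N => \sum_(k <- box d N) F k) c & cmod c <= B.
Proof.
move=> FB.
have [|c Fc] := @cauchy_climit R (fun N => \sum_(k <- box d N) F k).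
  move=> e e0; have [N0 tail] := box_tail FB e0; exists N0 => m n.
  wlog nm : m n / (n <= m)%N => [H|] mN nN.
    by case/orP: (leq_total n m) => ?; [exact: H | rewrite cmodC; exact: H].
  exact: le_trans (box_sum_dist F nm) (tail _ _ nN nm).
exists c => //; apply: (climit_le Fc); exists 0%N => N _.
exact: le_trans (cmod_sum _ _ _) (FB N).
Qed.

End BoxSums.

(** * Growth, exponentials and the sup-norm *)

Section Exponentials.
Variable R : realType.
Implicit Types s t : R.

Lemma expi0 : expi (0 : R) = 1.
Proof. by rewrite /expi cos0 sin0. Qed.

Lemma expiD s t : expi (s + t) = expi s * expi t.
Proof.
rewrite /expi cosD sinD; apply/eqP; rewrite eq_complex /= eqxx/=.
by rewrite addrC.
Qed.

Lemma expi_sum (I : finType) (F : I -> R) :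
  expi (\sum_i F i) = \prod_i expi (F i).
Proof. exact: (big_morph _ expiD expi0). Qed.

Lemma expiMn t n : expi (t *+ n) = expi t ^+ n.
Proof. by elim: n => [|n IH]; rewrite ?mulr0n ?expi0// mulrS expiD IH exprS. Qed.

Lemma cmod_expi t : cmod (expi t) = 1.
Proof. by rewrite /cmod /= cos2Dsin2 sqrtr1. Qed.

Lemma expi_2piM (z : int) : expi (z%:~R * (pi *+ 2)) = 1 :> R[i].
Proof.
have H (n : nat) : expi (n%:R * (pi *+ 2)) = 1 :> R[i].
  by rewrite mulr_natl expiMn /expi cos2pi sin2pi expr1n.
case: (intP z) => [|n|n]; rewrite ?mul0r ?expi0//; first exact: H.
by rewrite -[LHS]mulr1 -[X in _ * X](H n.+1) -expiD mulrNz mulNr addNr expi0.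
Qed.

(** If the value were 1, the cosine of the doubled angle would be 1, forcing sin |t| = 0, whereas
    the sine is positive on ]0, pi[. *)
Lemma expi_neq1 t : 0 < `|t| < pi -> expi (t *+ 2) != 1.
Proof.
move=> /sin_gt0_pi; apply: contraTneq => -[].
rewrite -cos_norm normrMn cos_mulr2n => cos1 _; rewrite -leNgt.
have /eqP : sin `|t| ^+ 2 = 0 by rewrite sin2cos2; move: cos1; lra.
by rewrite sqrf_eq0 => /eqP ->.
Qed.

(** A geometric sum of powers of a Q-th root of unity w: multiplied by w - 1 it gives w^Q - 1 = 0,
    and 0 < |n| < Q ensures w != 1. *)
Lemma expi_grid_sum (Q : nat) (n : int) : (0 < `|n| < Q)%N ->
  \sum_(l < Q) expi (pi *+ 2 * l%:R / Q%:R * n%:~R) = 0 :> R[i].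
Proof.
move=> /andP[n0 nQ]; have Q0 : 0 < Q%:R :> R by rewrite ltr0n (leq_ltn_trans _ nQ).
pose t : R := pi * n%:~R / Q%:R.
have -> : \sum_(l < Q) expi (pi *+ 2 * l%:R / Q%:R * n%:~R)
    = \sum_(l < Q) expi (t *+ 2) ^+ l.
  apply: eq_bigr => l _; rewrite -expiMn; congr expi.
  by rewrite -mulr_natr /t; ring.
have w1 : expi (t *+ 2) - 1 != 0.
  rewrite subr_eq0 expi_neq1// /t normrM normrM (ger0_norm (pi_ge0 R)).
  rewrite normfV (gtr0_norm Q0) -intr_norm -abszE -pmulrn; apply/andP; split.
    by rewrite divr_gt0// mulr_gt0 ?pi_gt0// ltr0n.
  by rewrite ltr_pdivrMr// ltr_pM2l ?pi_gt0// ltr_nat.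
apply: (mulfI w1); rewrite mulr0 -subrX1 -expiMn.
have -> : t *+ 2 *+ Q = n%:~R * (pi *+ 2).
  by rewrite -[LHS]mulr_natr /t; field; rewrite gt_eqF.
by rewrite expi_2piM subrr.
Qed.

End Exponentials.

Section Growth.
Variables (R : realType) (d : nat).
Implicit Types (f g phi : fseq R d) (k : Zd d).

Lemma slowly_growing_ge0 f : slowly_growing f ->
  exists (C : R) (n : nat),
    0 <= C /\ forall k, cmod (f k) <= C * (1 + knorm R k) ^+ n.
Proof.
move=> [C [n fC]]; exists C, n; split => //.
by have := le_trans (cmod_ge0 _) (fC 0); rewrite pmulr_lge0// kweightX_gt0.
Qed.

Lemma slowly_growing_lin (a : R[i]) f g : slowly_growing f -> slowly_growing g ->
  slowly_growing (fun k => a * f k + g k).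
Proof.
move=> /slowly_growing_ge0[C [m [C0 fC]]] /slowly_growing_ge0[D [n [D0 gD]]].
exists (cmod a * C + D), (m + n)%N => k.
apply: le_trans (cmodD _ _) _; rewrite mulrDl lerD//.
  rewrite cmodM -mulrA ler_wpM2l ?cmod_ge0//; apply: le_trans (fC k) _.
  by rewrite ler_wpM2l// ler_weXn2l ?kweight_ge1// leq_addr.
apply: le_trans (gD k) _.
by rewrite ler_wpM2l// ler_weXn2l ?kweight_ge1// leq_addl.
Qed.

Lemma slowly_growing_app f g : slowly_growing f -> slowly_growing g ->
  slowly_growing (app f g).
Proof.
move=> [C [m fC]] [D [n gD]]; exists (C * D), (m + n)%N => k.
by rewrite cmodM exprD mulrACA ler_pM ?cmod_ge0.
Qed.

Lemma rapid_seminorm phi n k : rapidly_decaying phi ->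
  cmod (phi k) * (1 + knorm R k) ^+ n <= Sseminorm n phi.
Proof.
move=> phiS; apply: ub_le_sup; last by exists k.
by have [C phiC] := phiS n; exists C; move=> _ [l _ <-]; exact: phiC.
Qed.

Lemma Sseminorm_ge0 phi n : rapidly_decaying phi -> 0 <= Sseminorm n phi.
Proof.
move=> phiS; apply: le_trans (rapid_seminorm n 0 phiS).
by rewrite mulr_ge0 ?cmod_ge0 ?ltW ?kweightX_gt0.
Qed.

Lemma Sseminorm_le phi n (C : R) :
  (forall k, cmod (phi k) * (1 + knorm R k) ^+ n <= C) -> Sseminorm n phi <= C.
Proof.
move=> phiC; apply: ge_sup; last by move=> _ [k _ <-].
by exists (cmod (phi 0) * (1 + knorm R (0 : Zd d)) ^+ n), 0.
Qed.

Lemma rapid_slowly_growing phi : rapidly_decaying phi -> slowly_growing phi.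
Proof.
move=> /(_ 0%N)[C phiC]; exists C, 0%N => k.
by have := phiC k; rewrite !expr0 !mulr1.
Qed.

(** A multiplier of growth order m costs m orders of decay. The constant is kept explicit for the
    continuity estimates. *)
Lemma app_rapid_bound f phi (C : R) m n k :
  (forall k, cmod (f k) <= C * (1 + knorm R k) ^+ m) -> 0 <= C ->
  rapidly_decaying phi ->
  cmod (app f phi k) * (1 + knorm R k) ^+ n <= C * Sseminorm (m + n) phi.
Proof.
move=> fC C0 phiS; rewrite cmodM.
apply: le_trans (_ : C * (cmod (phi k) * (1 + knorm R k) ^+ (m + n)) <= _).
  rewrite exprD mulrCA !mulrA ler_wpM2r//; first by rewrite ltW ?kweightX_gt0.
  by rewrite -mulrA mulrC ler_wpM2l ?cmod_ge0 ?fC.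
by rewrite ler_wpM2l// rapid_seminorm.
Qed.

Lemma app_rapid f phi : slowly_growing f -> rapidly_decaying phi ->
  rapidly_decaying (app f phi).
Proof.
move=> /slowly_growing_ge0[C [m [C0 fC]]] phiS n.
by exists (C * Sseminorm (m + n) phi) => k; exact: app_rapid_bound.
Qed.

Lemma finsupp_rapid (s : seq (Zd d)) phi : (forall k, k \notin s -> phi k = 0) ->
  rapidly_decaying phi.
Proof.
move=> phi0 n; pose F k := cmod (phi k) * (1 + knorm R k) ^+ n.
have F0 k : 0 <= F k by rewrite mulr_ge0 ?cmod_ge0 ?ltW ?kweightX_gt0.
exists (\sum_(k <- s) F k) => k; rewrite -/(F k).
have [ks|/phi0 phik] := boolP (k \in s); last first.
  by rewrite {1}/F phik cmod0 mul0r sumr_ge0.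
by rewrite (big_rem k ks)/= lerDl sumr_ge0.
Qed.

(** As a test function this is the exponential e_k; pairing a sequence with [delta (- k)] reads off
    its coefficient at k. *)
Definition delta k : fseq R d := fun l => (l == k)%:R.

Lemma delta_rapid k : rapidly_decaying (delta k).
Proof.
by apply: (@finsupp_rapid [:: k]) => l; rewrite inE /delta => /negbTE ->.
Qed.

End Growth.

(** * Sup-norm bounds and Fourier coefficients *)

Section SupNorm.
Variables (R : realType) (d : nat).
Implicit Types (phi : fseq R d) (k l : Zd d) (x : 'I_d -> R).

Lemma partial_evalE phi x N :
  partial_eval phi x N = \sum_(k <- box d N) phi k * expi (phase x k).
Proof. exact: (big_boxpt N (fun k => phi k * expi (phase x k))). Qed.

Lemma partial_eval_dist phi x N M : (N <= M)%N ->
  cmod (partial_eval phi x M - partial_eval phi x N)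
  <= \sum_(k <- box d M | k \notin box d N) cmod (phi k).
Proof.
move=> NM; rewrite !partial_evalE; apply: le_trans (box_sum_dist _ NM) _.
by apply: ler_sum => k _; rewrite cmodM cmod_expi mulr1.
Qed.

Lemma supnorm_fzero : supnorm_le1 (@fzero R d).
Proof.
move=> x e e0; exists 0%N => N _.
by rewrite /partial_eval big1 ?cmod0 ?addr_ge0 ?ltW// => j _; rewrite mul0r.
Qed.

Lemma supnorm_delta k : supnorm_le1 (delta R k).
Proof.
move=> x e e0; have [N0 kN] := mem_box_large [:: k]; exists N0 => N /kN {}kN.
rewrite partial_evalE (@big_box_supp _ _ N [:: k])//.
  by rewrite big_seq1 /delta eqxx mul1r cmod_expi lerDl ltW.
by move=> l; rewrite inE /delta => /negbTE ->; rewrite mul0r.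
Qed.

Definition grid (Q : nat) (j : {ffun 'I_d -> 'I_Q}) : 'I_d -> R :=
  fun i => pi *+ 2 * (j i)%:R / Q%:R.

(** The sum factors over coordinates. A coordinate where l and k differ contributes a vanishing
    root-of-unity sum; if there is none, each factor counts Q points. *)
Lemma grid_orthogonal (Q : nat) k l :
  (forall i, (`|l 0%R i - k 0%R i| < Q)%N) ->
  \sum_(j : {ffun 'I_d -> 'I_Q}) expi (phase (grid j) l) * expi (- phase (grid j) k)
  = (l == k)%:R * (Q%:R ^+ d) :> R[i].
Proof.
move=> klQ.
have -> : \sum_(j : {ffun 'I_d -> 'I_Q})
      expi (phase (grid j) l) * expi (- phase (grid j) k)
    = \prod_(i < d) \sum_(a < Q)
        expi (pi *+ 2 * a%:R / Q%:R * (l 0 i - k 0 i)%:~R) :> R[i].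
  rewrite bigA_distr_bigA; apply: eq_bigr => j _.
  rewrite -expiD -sumrB expi_sum; apply: eq_bigr => i _.
  by rewrite -mulrBr rmorphB.
have [->|lk] := eqVneq l k.
  rewrite mul1r (eq_bigr (fun=> Q%:R)) ?prodr_const ?card_ord// => i _.
  rewrite (eq_bigr (fun=> 1)) => [|a _]; last by rewrite subrr mulr0 expi0.
  by rewrite sumr_const card_ord.
have [i lki] : exists i, l 0 i != k 0 i.
  apply/existsP; apply: contra_neqT lk => /existsPn lk; apply/rowP => i.
  by apply/eqP; rewrite -[_ == _]negbK lk.
rewrite mul0r (bigD1 i)//= expi_grid_sum ?mul0r//.
by rewrite klQ andbT absz_gt0 subr_eq0.
Qed.

(* The grid has more than 2N points in each direction, so on it the
   exponentials with frequencies in the box of radius N are orthogonal. *)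
Lemma box_coefE phi N k : k \in box d N ->
  ((N.*2.+1)%:R ^+ d) * phi k = \sum_(j : {ffun 'I_d -> 'I_(N.*2.+1)})
    partial_eval phi (grid j) N * expi (- phase (grid j) k).
Proof.
move=> kN; under eq_bigr do rewrite partial_evalE mulr_suml.
rewrite exchange_big/= big_seq.
under eq_bigr => l lN.
  under eq_bigr do rewrite -mulrA.
  rewrite -mulr_sumr grid_orthogonal; last first.
    move=> i; move: lN kN; rewrite !mem_box => /forallP/(_ i) lN /forallP/(_ i).
    by move: lN; move: (l 0 i) (k 0 i) => a b; lia.
  over.
rewrite -big_seq (@big_box_supp _ _ N [:: k])//.
- by rewrite big_seq1 eqxx mul1r mulrC.
- by move=> l; rewrite inE => /eqP ->.
- by move=> l; rewrite inE => /negbTE ->; rewrite mul0r mulr0.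
Qed.

(** By [box_coefE], the coefficient is an average over the grid of partial evaluations times
    unimodular factors, and those evaluations are at most 1 + e. *)
Lemma supnorm_coef phi k : rapidly_decaying phi -> supnorm_le1 phi ->
  cmod (phi k) <= 1.
Proof.
move=> phiS phi1; apply/ler_addgt0Pr => e e0.
have e2 : 0 < e / 2 by rewrite divr_gt0.
have [C phiC] := phiS d.*2.
have [N0 tail] := box_tail (rapid_summable phiC) e2.
have [N1 kN1] := mem_box_large [:: k].
pose N := maxn N0 N1.
(* The threshold N2 provided by [supnorm_le1] depends on x. The tail estimate does not, so the bound
   passes to the single radius N used at all grid points. *)
have phiN x : cmod (partial_eval phi x N) <= 1 + e.
  have [N2 hN2] := phi1 x _ e2.
  apply: le_trans (cmod_sub_le _ (partial_eval phi x (maxn N N2))) _.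
  rewrite cmodC addrC [e]splitr addrA lerD ?hN2 ?leq_maxr//.
  by apply: le_trans (partial_eval_dist _ _ _) (tail _ _ _ _); rewrite leq_maxl.
have kN : k \in box d N by apply: kN1; rewrite ?leq_maxr ?mem_head.
have Qd0 : 0 < (N.*2.+1)%:R ^+ d :> R by rewrite exprn_gt0.
rewrite -(ler_pM2l Qd0).
have -> : (N.*2.+1)%:R ^+ d * cmod (phi k) = cmod ((N.*2.+1)%:R ^+ d * phi k).
  by rewrite cmodM cmodX cmod_nat.
rewrite box_coefE//; apply: le_trans (cmod_sum _ _ _) _.
apply: le_trans (_ : \sum_(j : {ffun 'I_d -> 'I_(N.*2.+1)}) (1 + e) <= _).
  by apply: ler_sum => j _; rewrite cmodM cmod_expi mulr1.
by rewrite sumr_const card_ffun !card_ord -natrX mulr_natl.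
Qed.

End SupNorm.

(** * Pairings and the total variation norm *)

Section Pairing.
Variables (R : realType) (d : nat).
Implicit Types (f g phi psi w : fseq R d) (k : Zd d) (a c : R[i]).

Lemma pairing_climit f phi c : pairing_to f phi c <->
  climit (fun N => \sum_(k <- box d N) f k * phi (- k)) c.
Proof.
have E N := big_boxpt N (fun k => f k * phi (- k)).
by split=> fc e /fc[N0 h]; exists N0 => N /h; rewrite E.
Qed.

Lemma pairing_unique f phi c c' :
  pairing_to f phi c -> pairing_to f phi c' -> c = c'.
Proof. by move=> /pairing_climit fc /pairing_climit; exact: climit_unique. Qed.

Lemma pairing_lin a f g phi b c : pairing_to f phi b -> pairing_to g phi c ->
  pairing_to (fun k => a * f k + g k) phi (a * b + c).
Proof.
move=> /pairing_climit/(climitZ a) fb /pairing_climit gc.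
apply/pairing_climit; apply: eq_climit (climitD fb gc); exists 0%N => N _.
rewrite mulr_sumr -big_split/=; apply: eq_bigr => k _.
by rewrite mulrDl mulrA.
Qed.

Lemma pairingZ a f phi c : pairing_to f phi c ->
  pairing_to (fun k => a * f k) phi (a * c).
Proof.
move=> /pairing_climit/(climitZ a) fc; apply/pairing_climit.
apply: eq_climit fc; exists 0%N => N _.
by rewrite mulr_sumr; apply: eq_bigr => k _; rewrite mulrA.
Qed.

(** Growth of order n is absorbed by decay of order n + 2d, so the pairing converges absolutely. The
    explicit bound serves both continuity into S' and passages to the limit. *)
Lemma pairing_ex_le f phi (C : R) n : 0 <= C ->
  (forall k, cmod (f k) <= C * (1 + knorm R k) ^+ n) -> rapidly_decaying phi ->
  exists2 c, pairing_to f phi c & cmod c <= C * Sseminorm (n + d.*2) phi * 4 ^+ d.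
Proof.
move=> C0 fC phiS.
have bnd k : cmod (f k * phi (- k)) * (1 + knorm R k) ^+ d.*2
    <= C * Sseminorm (n + d.*2) phi.
  (* The pairing multiplies [f k] by [phi (- k)], hence the reflected sequence taken at [- k]. *)
  have := @app_rapid_bound _ _ (fun l => f (- l)) phi C n d.*2 (- k) _ C0 phiS.
  by rewrite /app opprK knormN; apply => l; rewrite -(knormN R l).
have [c fc cle] := box_sum_climit (rapid_summable bnd).
by exists c => //; exact/pairing_climit.
Qed.

Lemma pairing_ex f phi : slowly_growing f -> rapidly_decaying phi ->
  exists c, pairing_to f phi c.
Proof.
move=> /slowly_growing_ge0[C [n [C0 fC]]] phiS.
by have [c fc _] := pairing_ex_le C0 fC phiS; exists c.
Qed.

Lemma pairing_delta w k : pairing_to w (delta R (- k)) (w k).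
Proof.
apply/pairing_climit; have [N0 kN] := mem_box_large [:: k].
apply: eq_climit (climit_cst (w k)); exists N0 => N /kN {}kN.
rewrite (@big_box_supp _ _ N [:: k])//.
  by rewrite big_seq1 /delta eqxx mulr1.
by move=> l; rewrite inE /delta eqr_opp => /negbTE ->; rewrite mulr0.
Qed.

End Pairing.

(** * The total variation norm and its completeness *)

Section MeasureNorm.
Variables (R : realType) (d : nat).
Implicit Types (v w phi psi : fseq R d) (k : Zd d) (a c : R[i]).

(** The bound hidden in [in_M], made explicit so that it can be proved before membership in M is
    known. *)
Definition M_bound w (B : R) := forall phi c,
  rapidly_decaying phi -> supnorm_le1 phi -> pairing_to w phi c -> cmod c <= B.

Let fzero_rapid : rapidly_decaying (@fzero R d).
Proof. exact: (@finsupp_rapid _ _ [::]). Qed.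

Lemma normM_le w (B : R) : M_bound w B -> normM w <= B.
Proof.
move=> wB; apply: ge_sup; last by move=> _ [phi [c [phiS phi1 wc ->]]]; exact: wB wc.
(* The supremum is over a nonempty set: the zero test function contributes 0. *)
exists (cmod 0), (@fzero R d), 0; split => //; first exact: supnorm_fzero.
apply/pairing_climit; apply: eq_climit (climit_cst 0); exists 0%N => N _.
by apply: big1 => k _; rewrite mulr0.
Qed.

Lemma le_normM w : in_M w -> M_bound w (normM w).
Proof.
move=> [_ [B wB]] phi c phiS phi1 wc; apply: ub_le_sup; last by exists phi, c.
by exists B; move=> _ [psi [b [psiS psi1 wb ->]]]; exact: wB wb.
Qed.

Lemma coef_le_normM w k : in_M w -> cmod (w k) <= normM w.
Proof.
move=> wM; apply: (le_normM wM (delta_rapid R (- k))); first exact: supnorm_delta.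
exact: pairing_delta.
Qed.

Lemma normM_ge0 w : in_M w -> 0 <= normM w.
Proof. by move=> wM; apply: le_trans (cmod_ge0 _) (coef_le_normM 0 wM). Qed.

Lemma M_bound_lin a v w (A B : R) : slowly_growing v -> slowly_growing w ->
  M_bound v A -> M_bound w B -> M_bound (fun k => a * v k + w k) (cmod a * A + B).
Proof.
move=> sv sw vA wB phi c phiS phi1 avwc.
have [b vb] := pairing_ex sv phiS; have [b' wb'] := pairing_ex sw phiS.
rewrite (pairing_unique avwc (pairing_lin a vb wb')).
apply: le_trans (cmodD _ _) _; rewrite cmodM lerD//; last exact: wB wb'.
by rewrite ler_wpM2l ?cmod_ge0//; exact: vA vb.
Qed.

Lemma in_M_lin a v w : in_M v -> in_M w -> in_M (fun k => a * v k + w k).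
Proof.
move=> [sv [A vA]] [sw [B wB]]; split; first exact: slowly_growing_lin.
exists (cmod a * A + B); exact: M_bound_lin.
Qed.

Lemma normM_lin a v w : in_M v -> in_M w ->
  normM (fun k => a * v k + w k) <= cmod a * normM v + normM w.
Proof.
move=> vM wM; apply/normM_le/M_bound_lin; [exact: vM.1 | exact: wM.1 | |];
exact: le_normM.
Qed.

(** Test functions of sup-norm at most 1 have coefficients at most 1, so every pairing is dominated
    by the l^1 norm of [psi]. *)
Lemma rapid_M_bound psi : rapidly_decaying psi ->
  M_bound psi (Sseminorm d.*2 psi * 4 ^+ d).
Proof.
move=> psiS phi c phiS phi1 psic.
have bnd k : cmod (psi k * phi (- k)) * (1 + knorm R k) ^+ d.*2
    <= Sseminorm d.*2 psi.
  apply: le_trans (rapid_seminorm d.*2 k psiS).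
  rewrite ler_wpM2r//; first by rewrite ltW// kweightX_gt0.
  by rewrite cmodM ler_piMr ?cmod_ge0// supnorm_coef.
have [c' psic' c'le] := box_sum_climit (rapid_summable bnd).
by move/pairing_climit: psic => psic; rewrite (climit_unique psic psic').
Qed.

Lemma rapid_in_M psi : rapidly_decaying psi -> in_M psi.
Proof.
move=> psiS; split; first exact: rapid_slowly_growing.
exists (Sseminorm d.*2 psi * 4 ^+ d); exact: rapid_M_bound.
Qed.

Lemma in_MZ a w : in_M w -> in_M (fun k => a * w k).
Proof.
move=> wM; have := in_M_lin a wM (rapid_in_M fzero_rapid).
by congr in_M; apply/funext => k; rewrite addr0.
Qed.

Lemma in_MB v w : in_M v -> in_M w -> in_M (fun k => v k - w k).
Proof.
move=> vM wM; have := in_M_lin (-1) wM vM.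
by congr in_M; apply/funext => k; rewrite mulN1r addrC.
Qed.

Lemma normMD v w : in_M v -> in_M w ->
  normM (fun k => v k + w k) <= normM v + normM w.
Proof.
move=> vM wM; have := normM_lin 1 vM wM; rewrite cmod1 mul1r.
by under eq_fun do rewrite mul1r.
Qed.

Lemma normMZ a w : in_M w -> normM (fun k => a * w k) = cmod a * normM w.
Proof.
have le_normMZ b v : in_M v -> normM (fun k => b * v k) <= cmod b * normM v.
  move=> vM; apply: normM_le => phi c phiS phi1 bvc.
  have [c' vc'] := pairing_ex vM.1 phiS.
  rewrite (pairing_unique bvc (pairingZ b vc')) cmodM ler_wpM2l ?cmod_ge0//.
  exact: le_normM vc'.
move=> wM; apply/eqP; rewrite eq_le le_normMZ//=.
have [->|a0] := eqVneq a 0; first by rewrite cmod0 mul0r normM_ge0//; exact: in_MZ.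
have ca0 : 0 < cmod a.
  rewrite lt0r cmod_ge0 andbT; apply: contra_neq a0; exact: cmod_eq0.
have aaV : cmod a * cmod a^-1 = 1 by rewrite -cmodM divff// cmod1.
(* The reverse inequality is the same one for the scalar 1/a acting on a w. *)
have := le_normMZ a^-1 _ (in_MZ a wM).
rewrite (_ : (fun k => a^-1 * (a * w k)) = w); last first.
  by apply/funext => k; rewrite mulKf.
by move=> /(ler_wpM2l (ltW ca0)); rewrite mulrA aaV mul1r.
Qed.

(** After the reflection k -> -k, the box sums of the pairing are the partial evaluations of [phi]
    at x, so the bound is 1. *)
Lemma dirac_in_M (x : 'I_d -> R) : in_M (dirac_at x).
Proof.
split; first by exists 1, 0%N => k; rewrite expr0 mulr1 cmod_expi.
exists 1 => phi c phiS phi1 /pairing_climit xc; apply/ler_addgt0Pr => e e0.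
have [N0 h] := phi1 x _ e0; apply: (climit_le xc); exists N0 => N /h.
rewrite partial_evalE -big_boxN; apply: le_trans.
rewrite le_eqVlt; apply/orP; left; apply/eqP; congr cmod; apply: eq_bigr => k _.
rewrite mulrC /dirac_at; congr (_ * expi _).
by rewrite /phase -sumrN; apply: eq_bigr => i _; rewrite mxE rmorphN mulrN.
Qed.

Lemma in_M_sum (K : nat) (a : 'I_K -> R[i]) (w : 'I_K -> fseq R d) :
  (forall j, in_M (w j)) -> in_M (fun k => \sum_(j < K) a j * w j k).
Proof.
move=> wM; elim: (index_enum _) => [|j s IH].
  have := rapid_in_M fzero_rapid.
  by congr in_M; apply/funext => k; rewrite big_nil.
have := in_M_lin (a j) (wM j) IH.
by congr in_M; apply/funext => k; rewrite big_cons.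
Qed.

(** Lower semicontinuity of the norm: a test function is absolutely summable, so uniform convergence
    of coefficients makes the pairings converge. *)
Lemma M_bound_limit (w : nat -> fseq R d) v (B : R) :
  (forall n, in_M (w n)) -> slowly_growing v ->
  (exists N, forall n, (N <= n)%N -> normM (w n) <= B) ->
  (forall e : R, 0 < e -> exists N, forall n, (N <= n)%N ->
     forall k, cmod (w n k - v k) <= e) ->
  M_bound v B.
Proof.
move=> wM sv [N1 wB] wv phi c phiS phi1 vc; apply/ler_addgt0Pr => e e0.
(* S is the factor of [pairing_ex_le] at growth order 0, since [w n - v] is bounded; dividing by S +
   1 allows S = 0. *)
pose S := Sseminorm (0 + d.*2) phi * 4 ^+ d.
have S0 : 0 <= S by rewrite mulr_ge0 ?Sseminorm_ge0 ?exprn_ge0.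
have S1 : 0 < S + 1 by rewrite ltr_wpDl.
have [N2 wvN] := wv _ (divr_gt0 e0 S1); pose n := maxn N1 N2.
have [c' wc'] := pairing_ex (wM n).1 phiS.
have : forall k, cmod (w n k - v k) <= e / (S + 1) * (1 + knorm R k) ^+ 0.
  by move=> k; rewrite expr0 mulr1 wvN// leq_maxr.
move=> /pairing_ex_le /(_ phiS)[|b wvb ble]; first by rewrite ltW// divr_gt0.
have -> : c = -1 * b + c'.
  apply: pairing_unique vc _; have := pairing_lin (-1) wvb wc'.
  by congr pairing_to; apply/funext => k; rewrite mulN1r opprB subrK.
apply: le_trans (cmodD _ _) _; rewrite addrC mulN1r cmodN lerD//.
  by apply: le_trans (wB n _); rewrite ?leq_maxl//; exact: le_normM wc'.
apply: le_trans ble _; rewrite -mulrA -/S mulrAC ler_pdivrMr//.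
by rewrite ler_wpM2l ?ltW// ltrDl.
Qed.

(** The norm dominates all coefficients uniformly, which yields a bounded coefficientwise limit;
    semicontinuity then upgrades this to convergence in norm. The coefficientwise limit is also
    returned, to identify L f in the native space. *)
Lemma normM_complete (w : nat -> fseq R d) : (forall n, in_M (w n)) ->
  (forall e : R, 0 < e -> exists N, forall m n, (N <= m)%N -> (N <= n)%N ->
     normM (fun k => w m k - w n k) <= e) ->
  exists v, [/\ in_M v, forall k, climit (fun n => w n k) (v k)
    & forall e : R, 0 < e -> exists N, forall n, (N <= n)%N ->
        normM (fun k => w n k - v k) <= e].
Proof.
move=> wM cw.
have coefB m n k : cmod (w m k - w n k) <= normM (fun k => w m k - w n k).
  exact: (coef_le_normM k (in_MB (wM m) (wM n))).
have /choice[v wv] k : exists c, climit (fun n => w n k) c.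
  apply: cauchy_climit => e /cw[N h]; exists N => m n mN nN.
  exact: le_trans (coefB m n k) (h _ _ mN nN).
have unif (e : R) : 0 < e -> exists N, forall n, (N <= n)%N ->
    forall k, cmod (w n k - v k) <= e.
  move=> /cw[N h]; exists N => n nN k; rewrite cmodC.
  have vw : climit (fun m => w m k + - w n k) (v k - w n k).
    exact: climitD (wv k) (climit_cst _).
  apply: (climit_le vw); exists N => m mN.
  exact: le_trans (coefB m n k) (h _ _ mN nN).
have sv : slowly_growing v.
  have [N h] := unif 1 ltr01.
  exists (1 + normM (w N)), 0%N => k; rewrite expr0 mulr1.
  apply: le_trans (cmod_sub_le _ (w N k)) _.
  by rewrite cmodC lerD ?h// coef_le_normM.
have close (e : R) : 0 < e -> exists N, forall n, (N <= n)%N ->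
    M_bound (fun k => w n k - v k) e.
  move=> /cw[N h]; exists N => n nN.
  (* With n fixed, m tends to infinity in the Cauchy estimate. *)
  apply: (@M_bound_limit (fun m k => w n k - w m k)).
  - by move=> m; exact: in_MB.
  - have := slowly_growing_lin (-1) sv (wM n).1.
    by congr slowly_growing; apply/funext => k; rewrite mulN1r addrC.
  - by exists N => m mN; exact: h.
  - move=> e' /unif[N' h']; exists N' => m mN' k.
    by rewrite opprB addrC addrA subrK cmodC h'.
exists v; split => //; last first.
  by move=> e /close[N h]; exists N => n /h; exact: normM_le.
have [N h] := close 1 ltr01; split => //.
(* This bounds v written as -(w N - v) + w N. *)
exists (cmod (-1) * 1 + normM (w N)).
have swv : slowly_growing (fun k => w N k - v k).
  have := slowly_growing_lin (-1) sv (wM N).1.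
  by congr slowly_growing; apply/funext => k; rewrite mulN1r addrC.
have := @M_bound_lin (-1) _ _ _ _ swv (wM N).1 (h N (leqnn N)) (le_normM (wM N)).
suff -> : (fun k => -1 * (w N k - v k) + w N k) = v by [].
by apply/funext => k; rewrite mulN1r opprB subrK.
Qed.

End MeasureNorm.

(** * Finite-dimensional norms and the null space *)

Section Minkowski.
Variable R : realType.
Implicit Types (r : R) (p : \bar R).

Lemma powRKV r (x : R) : r != 0 -> 0 <= x -> (x `^ r^-1) `^ r = x.
Proof. by move=> r0 x0; rewrite -powRrM mulVf// powRr1. Qed.

Lemma powRVK r (x : R) : r != 0 -> 0 <= x -> (x `^ r) `^ r^-1 = x.
Proof. by move=> r0 x0; rewrite -powRrM mulfV// powRr1. Qed.

Lemma powR_div r (x y : R) : 0 <= x -> 0 < y -> (x / y) `^ r = x `^ r / y `^ r.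
Proof.
move=> x0 y0; rewrite powRM ?invr_ge0 ?(ltW y0)//; congr (_ * _).
by rewrite -powR_inv1 ?(ltW y0)// -powRrM mulN1r powRN.
Qed.

Lemma powR_convex r (t x y : R) : 1 <= r -> 0 <= t -> t <= 1 -> 0 <= x -> 0 <= y ->
  (t * x + (1 - t) * y) `^ r <= t * x `^ r + (1 - t) * y `^ r.
Proof.
move=> r1 t0 t1 x0 y0.
have := @convex_powR R r r1 (Itv01 t0 t1) x y; rewrite !convRE /unstable.onem/=.
by apply; rewrite inE/= in_itv/= andbT.
Qed.

(** (x + y) / (A + B) is the convex combination of x / A and y / B with weight A / (A + B), and the
    r-th power is convex. *)
Lemma powRD_convex r (A B x y : R) : 1 <= r -> 0 < A -> 0 < B -> 0 <= x -> 0 <= y ->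
  (x + y) `^ r <= (A + B) `^ r *
    (A / (A + B) * (x `^ r / A `^ r) + (1 - A / (A + B)) * (y `^ r / B `^ r)).
Proof.
move=> r1 A0 B0 x0 y0; have AB0 : 0 < A + B by rewrite addr_gt0.
set t := A / (A + B).
have t0 : 0 <= t by rewrite divr_ge0 ?(ltW A0) ?(ltW AB0).
have t1 : t <= 1 by rewrite ler_pdivrMr// mul1r lerDl (ltW B0).
have xA : 0 <= x / A by rewrite divr_ge0// (ltW A0).
have yB : 0 <= y / B by rewrite divr_ge0// (ltW B0).
have -> : x + y = (A + B) * (t * (x / A) + (1 - t) * (y / B)).
  by rewrite /t; field; rewrite !gt_eqF.
rewrite powRM ?(ltW AB0)//; last first.
  by apply: addr_ge0; apply: mulr_ge0; rewrite ?subr_ge0.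
by rewrite ler_wpM2l ?powR_ge0// -!powR_div//; exact: powR_convex.
Qed.

(** Summing [powRD_convex] leaves a convex combination of two normalized sums, each at most 1. A and
    B are positive majorants of the norms, so that division is possible. *)
Lemma minkowski_le (I : Type) (s : seq I) r (F G : I -> R) (A B : R) : 1 <= r ->
  (forall i, 0 <= F i) -> (forall i, 0 <= G i) -> 0 < A -> 0 < B ->
  \sum_(i <- s) F i `^ r <= A `^ r -> \sum_(i <- s) G i `^ r <= B `^ r ->
  (\sum_(i <- s) (F i + G i) `^ r) `^ r^-1 <= A + B.
Proof.
move=> r1 F0 G0 A0 B0 FA GB; have r0 : 0 < r by exact: lt_le_trans r1.
have AB0 : 0 < A + B by exact: addr_gt0.
rewrite -[leRHS](@powRVK r) ?gt_eqF ?(ltW AB0)//.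
apply: ge0_ler_powR; rewrite ?nnegrE ?powR_ge0 ?invr_ge0 ?(ltW r0)//.
  by apply: sumr_ge0 => i _; exact: powR_ge0.
apply: le_trans (ler_sum _ (fun i _ => powRD_convex r1 A0 B0 (F0 i) (G0 i))) _.
rewrite -mulr_sumr big_split/= -!mulr_sumr -!mulr_suml.
set t := A / (A + B).
have t0 : 0 <= t by rewrite divr_ge0 ?(ltW A0) ?(ltW AB0).
have t1 : t <= 1 by rewrite ler_pdivrMr// mul1r lerDl (ltW B0).
rewrite ler_piMr ?powR_ge0//.
apply: le_trans (_ : t * 1 + (1 - t) * 1 <= _); last by rewrite !mulr1 subrKC.
apply: lerD; apply: ler_wpM2l; rewrite ?subr_ge0//.
- by rewrite ler_pdivrMr ?powR_gt0// mul1r.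
- by rewrite ler_pdivrMr ?powR_gt0// mul1r.
Qed.

Lemma minkowski_seq (I : Type) (s : seq I) r (F G : I -> R) : 1 <= r ->
  (forall i, 0 <= F i) -> (forall i, 0 <= G i) ->
  (\sum_(i <- s) (F i + G i) `^ r) `^ r^-1
  <= (\sum_(i <- s) F i `^ r) `^ r^-1 + (\sum_(i <- s) G i `^ r) `^ r^-1.
Proof.
move=> r1 F0 G0; have r0 : 0 < r by exact: lt_le_trans r1.
(* A norm may vanish, so each is enlarged slightly to give the positive majorants of
   [minkowski_le]. *)
have enlarge (H : I -> R) (e : R) : 0 < e ->
    0 < (\sum_(i <- s) H i `^ r) `^ r^-1 + e /\
    \sum_(i <- s) H i `^ r <= ((\sum_(i <- s) H i `^ r) `^ r^-1 + e) `^ r.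
  move=> e0; set X := \sum_(i <- s) _.
  have X0 : 0 <= X by apply: sumr_ge0 => i _; exact: powR_ge0.
  have Y0 : 0 <= X `^ r^-1 by exact: powR_ge0.
  split; first by exact: ltr_wpDl.
  rewrite -{1}(@powRKV r X) ?gt_eqF//; apply: ge0_ler_powR; rewrite ?nnegrE ?(ltW r0)//.
    by rewrite addr_ge0// (ltW e0).
  by rewrite lerDl (ltW e0).
apply/ler_addgt0Pr => e e0; have e2 : 0 < e / 2 by rewrite divr_gt0.
have [A0 FA] := enlarge F _ e2; have [B0 GB] := enlarge G _ e2.
apply: le_trans (minkowski_le r1 F0 G0 A0 B0 FA GB) _.
by rewrite addrACA -splitr.
Qed.

Lemma l2_triangle (I : Type) (s : seq I) (F G : I -> R) :
  (forall i, 0 <= F i) -> (forall i, 0 <= G i) ->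
  Num.sqrt (\sum_(i <- s) (F i + G i) ^+ 2)
  <= Num.sqrt (\sum_(i <- s) F i ^+ 2) + Num.sqrt (\sum_(i <- s) G i ^+ 2).
Proof.
move=> F0 G0.
have sqrtE (H : I -> R) : (forall i, 0 <= H i) ->
    Num.sqrt (\sum_(i <- s) H i ^+ 2) = (\sum_(i <- s) H i `^ 2) `^ 2^-1.
  move=> H0; rewrite powR12_sqrt; last by apply: sumr_ge0 => i _; exact: powR_ge0.
  by congr Num.sqrt; apply: eq_bigr => i _; rewrite powR_mulrn.
rewrite !sqrtE//; last by move=> i; rewrite addr_ge0.
by apply: minkowski_seq => //; rewrite ler1n.
Qed.

(* The p-norm on R^2, so that [normML p Lh f] is the p-norm of
   [(normM (app Lh f), projN_norm2 Lh f)]. *)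
Definition pnorm p (a b : R) : R :=
  match p with
  | EFin r => powR (powR a r + powR b r) r^-1
  | _ => Num.max a b
  end.

Lemma pnorm_le p (a b a' b' : R) : (1 <= p)%E -> 0 <= a -> 0 <= b ->
  a <= a' -> b <= b' -> pnorm p a b <= pnorm p a' b'.
Proof.
case: p => [r||//] /=; rewrite ?lee_fin => r1 a0 b0 aa' bb'; last first.
  by rewrite ge_max !le_max aa' bb' orbT.
have r0 : 0 <= r by exact: le_trans r1.
have a'0 := le_trans a0 aa'; have b'0 := le_trans b0 bb'.
apply: ge0_ler_powR; rewrite ?nnegrE ?invr_ge0 ?addr_ge0 ?powR_ge0//.
by rewrite lerD// ge0_ler_powR ?nnegrE.
Qed.

Lemma pnormZ p (c a b : R) : (1 <= p)%E -> 0 <= c -> 0 <= a -> 0 <= b ->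
  pnorm p (c * a) (c * b) = c * pnorm p a b.
Proof.
case: p => [r||//] /=; rewrite ?lee_fin => r1 c0 a0 b0; last by rewrite maxr_pMr.
rewrite !powRM// -mulrDr powRM ?addr_ge0 ?powR_ge0// powRVK//.
by rewrite gt_eqF// (lt_le_trans ltr01 r1).
Qed.

Lemma pnormD p (a b a' b' : R) : (1 <= p)%E -> 0 <= a -> 0 <= b -> 0 <= a' -> 0 <= b' ->
  pnorm p (a + a') (b + b') <= pnorm p a b + pnorm p a' b'.
Proof.
case: p => [r||//] /=; rewrite ?lee_fin => r1 a0 b0 a'0 b'0; last first.
  by rewrite ge_max !lerD// le_max lexx ?orbT.
have := @minkowski_seq _ [:: true; false] r (fun i => if i then a else b)
  (fun i => if i then a' else b') r1.
by rewrite !big_cons !big_nil !addr0; apply; case.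
Qed.

Lemma pnorm0r p (a : R) : (1 <= p)%E -> 0 <= a -> pnorm p a 0 = a.
Proof.
case: p => [r||//] /=; rewrite ?lee_fin => r1 a0; last by rewrite max_l.
have r0 : r != 0 by rewrite gt_eqF// (lt_le_trans ltr01 r1).
by rewrite powR0// addr0 powRVK.
Qed.

Lemma pnormC p (a b : R) : pnorm p a b = pnorm p b a.
Proof. by case: p => [r||] /=; [rewrite addrC | exact: maxC | exact: maxC]. Qed.

Lemma le_pnorm p (a b : R) : (1 <= p)%E -> 0 <= a -> 0 <= b -> a <= pnorm p a b.
Proof. by move=> p1 a0 b0; rewrite -[leLHS](pnorm0r p1)//; exact: pnorm_le. Qed.

(** Triangle inequality for (a, b) = (a, 0) + (0, b). *)
Lemma pnorm_le_add p (a b : R) : (1 <= p)%E -> 0 <= a -> 0 <= b ->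
  pnorm p a b <= a + b.
Proof.
move=> p1 a0 b0; have := pnormD p1 a0 (lexx 0) (lexx 0) b0.
by rewrite addr0 add0r pnorm0r// [X in _ + X]pnormC pnorm0r.
Qed.

End Minkowski.

Section NullSpace.
Variables (R : realType) (d : nat).
Implicit Types (Lh f g : fseq R d) (k : Zd d).

(* The exponentials of the null space factor the identity matrix of size #points
   through the coordinates on a spanning family, so rank bounds #points. *)
Lemma null_set_finite Lh : spline_admissible Lh -> finite_set [set k | Lh k = 0].
Proof.
move=> [_ [s nullE] _]; apply: contrapT => /(infinite_set_fset (size s).+1)[B BL sB].
pose n := (size s).+1; pose pt (i : 'I_n) : Zd d := nth 0 (finmap.enum_fset B) i.
have ptB (i : 'I_n) : pt i \in finmap.enum_fset B.
  by apply: mem_nth; exact: leq_trans (ltn_ord i) sB.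
have pt_inj i j : (pt i == pt j) = (i == j).
  rewrite nth_uniq ?finmap.fset_uniq// ?(leq_trans (ltn_ord _) sB)//.
have /choice[c cE] (i : 'I_n) : exists c : 'I_(size s) -> R[i],
    delta R (pt i) = fun k => \sum_(j < size s) c j * nth (@fzero R d) s j k.
  apply/nullE; split; first exact/rapid_slowly_growing/delta_rapid.
  apply/funext => k; rewrite /app /delta; have [->|_] := eqVneq k (pt i).
    by rewrite (_ : Lh _ = 0) ?mul0r//; exact: (BL _ (ptB i)).
  by rewrite mulr0.
pose C : 'M[R[i]]_(n, size s) := \matrix_(i, j) c i j.
pose S : 'M[R[i]]_(size s, n) := \matrix_(j, i) nth (@fzero R d) s j (pt i).
have CS : C *m S = 1%:M.
  apply/matrixP => i l; rewrite !mxE.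
  have /(congr1 (fun f => f (pt l))) := cE i; rewrite /delta pt_inj eq_sym => ->.
  by apply: eq_bigr => j _; rewrite !mxE.
have := leq_trans (mxrankM_maxl C S) (rank_leq_col C).
by rewrite CS mxrank1 ltnn.
Qed.

(** Finiteness of the null set turns the set-indexed sum of [projN_norm2] into a sum over a list, on
    which the later estimates rest. *)
Lemma null_seqP Lh : spline_admissible Lh -> exists s : seq (Zd d),
  (forall k, (k \in s) = (Lh k == 0)) /\
  (forall f, projN_norm2 Lh f = Num.sqrt (\sum_(k <- s) cmod (f k) ^+ 2)).
Proof.
move=> /null_set_finite finL.
exists (finmap.enum_fset (fset_set [set k | Lh k = 0])); split=> [k|f].
  have := in_fset_set finL k; rewrite /= => ->.
  by apply/idP/eqP; rewrite inE.
by rewrite /projN_norm2 fsbig_finite.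
Qed.

Lemma projN_norm2_ge0 Lh f : 0 <= projN_norm2 Lh f.
Proof. exact: sqrtr_ge0. Qed.

Lemma coef_le_projN_norm2 Lh f k : spline_admissible Lh -> Lh k = 0 ->
  cmod (f k) <= projN_norm2 Lh f.
Proof.
move=> /null_seqP[s [sL ->]] /eqP; rewrite -sL => ks.
rewrite -[leLHS]ger0_norm ?cmod_ge0// -sqrtr_sqr ler_wsqrtr// (big_rem k ks)/=.
by rewrite lerDl sumr_ge0// => l _; rewrite sqr_ge0.
Qed.

Lemma projN_norm2_le Lh : spline_admissible Lh -> exists K : R, 0 <= K /\
  forall f (B : R), 0 <= B -> (forall k, Lh k = 0 -> cmod (f k) <= B) ->
    projN_norm2 Lh f <= K * B.
Proof.
(* Each of the [size s] squares is at most B^2. *)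
move=> /null_seqP[s [sL projE]]; exists (Num.sqrt (size s)%:R).
split=> [|f B B0 fB]; first exact: sqrtr_ge0.
rewrite projE -[X in _ * X]ger0_norm// -sqrtr_sqr -sqrtrM// ler_wsqrtr//.
have -> : (size s)%:R * B ^+ 2 = \sum_(k <- s) B ^+ 2.
  by rewrite big_const_seq count_predT iter_addr_0 mulr_natl.
rewrite big_seq [leRHS]big_seq; apply: ler_sum => k.
rewrite sL => /eqP /fB fk.
by rewrite lerXn2r ?nnegrE ?cmod_ge0.
Qed.

Lemma projN_norm2Z Lh a f : spline_admissible Lh ->
  projN_norm2 Lh (fun k => a * f k) = cmod a * projN_norm2 Lh f.
Proof.
move=> /null_seqP[s [_ projE]]; rewrite !projE.
under eq_bigr do rewrite cmodM exprMn.
by rewrite -mulr_sumr sqrtrM ?sqr_ge0// sqrtr_sqr ger0_norm ?cmod_ge0.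
Qed.

Lemma projN_norm2D Lh f g : spline_admissible Lh ->
  projN_norm2 Lh (fun k => f k + g k) <= projN_norm2 Lh f + projN_norm2 Lh g.
Proof.
move=> /null_seqP[s [_ projE]]; rewrite !projE.
apply: le_trans (l2_triangle _ (fun k => cmod_ge0 (f k)) (fun k => cmod_ge0 (g k))).
apply: ler_wsqrtr; apply: ler_sum => k _.
by rewrite lerXn2r ?nnegrE ?addr_ge0 ?cmod_ge0// cmodD.
Qed.

Lemma pinv_null Lh Ld k : is_pinv Lh Ld -> Lh k = 0 -> Ld k = 0.
Proof. by move=> [_ _ H _ _] Lk; rewrite -H Lk mulr0 mul0r. Qed.

Lemma pinv_mul1 Lh Ld k : is_pinv Lh Ld -> Lh k != 0 -> Lh k * Ld k = 1.
Proof. by move=> [_ H _ _ _] Lk; apply: (mulIf Lk); rewrite H mul1r. Qed.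

End NullSpace.

(** * The native space *)

Section NativeSpace.
Variables (R : realType) (d : nat) (Lh Ld : fseq R d).
Hypotheses (admL : spline_admissible Lh) (pinvL : is_pinv Lh Ld).
Implicit Types (f g w q phi : fseq R d) (k : Zd d) (a : R[i]) (p : \bar R).

Let slowL : slowly_growing Lh. Proof. by case: admL. Qed.
Let slowLd : slowly_growing Ld. Proof. by case: pinvL. Qed.

Lemma app_lin a f g :
  app Lh (fun k => a * f k + g k) = fun k => a * app Lh f k + app Lh g k.
Proof. by apply/funext => k; rewrite /app mulrDr mulrCA. Qed.

Lemma appD f g : app Lh (fun k => f k + g k) = fun k => app Lh f k + app Lh g k.
Proof. by apply/funext => k; rewrite /app mulrDr. Qed.

Lemma appB f g : app Lh (fun k => f k - g k) = fun k => app Lh f k - app Lh g k.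
Proof. by apply/funext => k; rewrite /app mulrBr. Qed.

Lemma appZ a f : app Lh (fun k => a * f k) = fun k => a * app Lh f k.
Proof. by apply/funext => k; rewrite /app mulrCA. Qed.

Lemma null_supp_rapid f : (forall k, Lh k != 0 -> f k = 0) -> rapidly_decaying f.
Proof.
move=> f0; have [s [sL _]] := null_seqP admL.
by apply: (@finsupp_rapid _ _ s) => k; rewrite sL; exact: f0.
Qed.

Lemma in_ML_lin a f g : in_ML Lh f -> in_ML Lh g ->
  in_ML Lh (fun k => a * f k + g k).
Proof.
move=> [sf Mf] [sg Mg]; split; first exact: slowly_growing_lin.
by rewrite app_lin; exact: in_M_lin.
Qed.

Lemma in_MLB f g : in_ML Lh f -> in_ML Lh g -> in_ML Lh (fun k => f k - g k).
Proof.
move=> Mf Mg; have := in_ML_lin (-1) Mg Mf.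
by congr in_ML; apply/funext => k; rewrite mulN1r addrC.
Qed.

(* L (Ld w) differs from w by a trigonometric polynomial supported on the null set. *)
Lemma in_M_proj w : in_M w -> in_M (app Lh (app Ld w)).
Proof.
move=> wM; pose q k := app Lh (app Ld w) k - w k.
have qM : in_M q.
  apply/rapid_in_M/null_supp_rapid => k Lk.
  by rewrite /q /app mulrA pinv_mul1// mul1r subrr.
have := in_M_lin 1 qM wM.
by congr in_M; apply/funext => k; rewrite mul1r subrK.
Qed.

(** Take w = L f and q = f - Ld (L f), killed by L because L Ld L = L. Conversely L annihilates q,
    and L (Ld w) is a measure by [in_M_proj]. *)
Lemma in_ML_decomp f : in_ML Lh f <->
  exists w q, [/\ in_M w, in_null Lh q & f = (fun k => app Ld w k + q k)].
Proof.
split=> [[sf Mf]|[w [q [wM [sq q0] ->]]]].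
  exists (app Lh f), (fun k => -1 * app Ld (app Lh f) k + f k); split => //.
    split; first by exact: slowly_growing_lin (slowly_growing_app slowLd Mf.1) sf.
    apply/funext => k; rewrite app_lin /app /fzero mulN1r !mulrA.
    by case: pinvL => _ -> _ _ _; rewrite addNr.
  by apply/funext => k; rewrite mulN1r addNKr.
have Lq : app Lh (fun k => app Ld w k + q k) = app Lh (app Ld w).
  by rewrite appD q0; apply/funext => k; rewrite addr0.
split; last by rewrite Lq; exact: in_M_proj.
have := slowly_growing_lin 1 (slowly_growing_app slowLd wM.1) sq.
by congr slowly_growing; apply/funext => k; rewrite mul1r.
Qed.

(** Ld w = Ld (L (Ld w)), which vanishes as soon as L (Ld w) does. *)
Lemma range_null_trivial w : in_null Lh (app Ld w) -> app Ld w = @fzero R d.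
Proof.
move=> [_ Lw0]; apply/funext => k; rewrite /app; case: pinvL => _ _ <- _ _.
have /(congr1 (fun f => f k)) := Lw0; rewrite /app /fzero => E.
by rewrite -!mulrA E mulr0.
Qed.

Lemma normM_ge0_ML f : in_ML Lh f -> 0 <= normM (app Lh f).
Proof. by move=> [_ /normM_ge0]. Qed.

Lemma normMLE p f :
  normML p Lh f = pnorm p (normM (app Lh f)) (projN_norm2 Lh f).
Proof. by []. Qed.

Lemma normML_ge p f : (1 <= p)%E -> in_ML Lh f ->
  normM (app Lh f) <= normML p Lh f /\ projN_norm2 Lh f <= normML p Lh f.
Proof.
move=> p1 Mf; have a0 := normM_ge0_ML Mf; have b0 := projN_norm2_ge0 Lh f.
rewrite normMLE; split; first exact: le_pnorm.
by rewrite pnormC; exact: le_pnorm.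
Qed.

Lemma normML_ge0 p f : (1 <= p)%E -> in_ML Lh f -> 0 <= normML p Lh f.
Proof. by move=> p1 Mf; apply: le_trans (normM_ge0_ML Mf) (normML_ge p1 Mf).1. Qed.

Lemma normML_le_add p f : (1 <= p)%E -> in_ML Lh f ->
  normML p Lh f <= normM (app Lh f) + projN_norm2 Lh f.
Proof. by move=> p1 Mf; apply: pnorm_le_add; rewrite ?normM_ge0_ML ?projN_norm2_ge0. Qed.

Lemma normMLZ p a f : (1 <= p)%E -> in_ML Lh f ->
  normML p Lh (fun k => a * f k) = cmod a * normML p Lh f.
Proof.
move=> p1 Mf; rewrite !normMLE appZ (normMZ a Mf.2) projN_norm2Z//.
by rewrite pnormZ ?cmod_ge0 ?normM_ge0_ML ?projN_norm2_ge0.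
Qed.

Lemma normMLD p f g : (1 <= p)%E -> in_ML Lh f -> in_ML Lh g ->
  normML p Lh (fun k => f k + g k) <= normML p Lh f + normML p Lh g.
Proof.
move=> p1 Mf Mg; have a0 := normM_ge0_ML Mf; have a'0 := normM_ge0_ML Mg.
have b0 := projN_norm2_ge0 Lh f; have b'0 := projN_norm2_ge0 Lh g.
apply: le_trans (pnormD p1 a0 b0 a'0 b'0).
apply: pnorm_le => //.
- have := normM_ge0_ML (in_ML_lin 1 Mf Mg).
  by under eq_fun do rewrite mul1r.
- exact: projN_norm2_ge0.
- by rewrite appD; exact: (normMD Mf.2 Mg.2).
- exact: projN_norm2D.
Qed.

(* Off the null set [f = Ld (L f)]; on it the coefficients of [f] are seen by
   the projection. *)
Lemma coef_le_normML p f k : (1 <= p)%E -> in_ML Lh f ->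
  cmod (f k) <= (cmod (Ld k) + 1) * normML p Lh f.
Proof.
move=> p1 Mf; have [leM leP] := normML_ge p1 Mf; rewrite mulrDl mul1r.
have N0 := normML_ge0 p1 Mf.
have [Lk|Lk] := eqVneq (Lh k) 0.
  rewrite ler_wpDl ?mulr_ge0 ?cmod_ge0//.
  exact: le_trans (coef_le_projN_norm2 f admL Lk) leP.
have -> : f k = Ld k * app Lh f k by rewrite /app mulrA (mulrC (Ld k)) pinv_mul1// mul1r.
rewrite ler_wpDr// cmodM ler_wpM2l ?cmod_ge0//.
exact: le_trans (coef_le_normM k Mf.2) leM.
Qed.

Lemma normML_eq0 p f : (1 <= p)%E -> in_ML Lh f -> normML p Lh f = 0 -> f = @fzero R d.
Proof.
move=> p1 Mf N0; apply/funext => k; apply/cmod_eq0/eqP.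
by rewrite eq_le cmod_ge0 andbT (le_trans (coef_le_normML k p1 Mf))// N0 mulr0.
Qed.

(** Each norm lies between the maximum and the sum of its two components, whence a factor 2
    independent of both exponents. *)
Lemma normML_equiv p p' f : (1 <= p)%E -> (1 <= p')%E -> in_ML Lh f ->
  normML p Lh f <= 2 * normML p' Lh f.
Proof.
move=> p1 p'1 Mf; have [leM leP] := normML_ge p'1 Mf.
by apply: le_trans (normML_le_add p1 Mf) _; rewrite mulr_natl mulr2n lerD.
Qed.

Lemma rapid_in_ML phi : rapidly_decaying phi -> in_ML Lh phi.
Proof.
move=> phiS; split; first exact: rapid_slowly_growing.
exact/rapid_in_M/app_rapid.
Qed.

Lemma normML_Sseminorm p : (1 <= p)%E -> exists (C : R) (n : nat),
  forall phi, rapidly_decaying phi -> normML p Lh phi <= C * Sseminorm n phi.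
Proof.
move=> p1; have [C [m [C0 LC]]] := slowly_growing_ge0 slowL.
have [K [K0 projK]] := projN_norm2_le admL.
(* L costs m orders of decay, summability 2d more and a factor 4^d; K accounts for the
   projection. *)
exists (C * 4 ^+ d + K), (m + d.*2)%N => phi phiS.
have S0 := Sseminorm_ge0 (m + d.*2) phiS.
apply: le_trans (normML_le_add p1 (rapid_in_ML phiS)) _; rewrite mulrDl lerD//.
  apply: le_trans (normM_le (rapid_M_bound (app_rapid slowL phiS))) _.
  rewrite mulrAC ler_wpM2r ?exprn_ge0//.
  by apply: Sseminorm_le => k; exact: app_rapid_bound.
apply: projK => // k _; apply: le_trans (rapid_seminorm (m + d.*2) k phiS).
by rewrite ler_peMr ?cmod_ge0// exprn_ege1// kweight_ge1.
Qed.

(** Continuity into S' for the weak-* topology, one test function at a time: by [coef_le_normML], f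
    grows no faster than the bound for Ld, with a constant proportional to its norm. *)
Lemma pairing_normML p phi : (1 <= p)%E -> rapidly_decaying phi ->
  exists C : R, forall f, in_ML Lh f ->
    exists c, pairing_to f phi c /\ cmod c <= C * normML p Lh f.
Proof.
move=> p1 phiS; have [C [m [C0 LdC]]] := slowly_growing_ge0 slowLd.
exists ((C + 1) * Sseminorm (m + d.*2) phi * 4 ^+ d) => f Mf.
have N0 := normML_ge0 p1 Mf.
have CN0 : 0 <= (C + 1) * normML p Lh f by rewrite mulr_ge0// addr_ge0.
have fC k : cmod (f k) <= (C + 1) * normML p Lh f * (1 + knorm R k) ^+ m.
  apply: le_trans (coef_le_normML k p1 Mf) _; rewrite [leRHS]mulrAC.
  by rewrite ler_wpM2r// mulrDl mul1r lerD// exprn_ege1// kweight_ge1.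
have [c fc cle] := pairing_ex_le CN0 fC phiS; exists c; split => //.
by apply: le_trans cle _; rewrite le_eqVlt; apply/orP; left; apply/eqP; ring.
Qed.

Lemma Lspline_in_ML f : is_Lspline Lh f -> in_ML Lh f.
Proof.
move=> [sf [K [a [x [_ _ Lf]]]]]; split => //; rewrite Lf.
by apply: in_M_sum => j; exact: dirac_in_M.
Qed.

Lemma normML_complete p (u : nat -> fseq R d) : (1 <= p)%E ->
  (forall n, in_ML Lh (u n)) ->
  (forall eps : R, 0 < eps -> exists N, forall m n, (N <= m)%N -> (N <= n)%N ->
     normML p Lh (fun k => u m k - u n k) < eps) ->
  exists f, in_ML Lh f /\
    (forall eps : R, 0 < eps -> exists N, forall n, (N <= n)%N ->
       normML p Lh (fun k => u n k - f k) < eps).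
Proof.
move=> p1 uM cu; have uB m n := in_MLB (uM m) (uM n).
have [|v [vM wv vclose]] :=
  @normM_complete _ _ (fun n => app Lh (u n)) (fun n => (uM n).2).
  move=> e /cu[N h]; exists N => m n mN nN; rewrite -appB.
  exact: le_trans (normML_ge p1 (uB m n)).1 (ltW (h _ _ mN nN)).
(* Limits are taken on the null set only; elsewhere 0 is a placeholder. *)
have /choice[q uq] k : exists c, Lh k = 0 -> climit (fun n => u n k) c.
  have [Lk|/eqP Lk] := eqVneq (Lh k) 0; last by exists 0.
  have [|c uc] := @cauchy_climit R (fun n => u n k); last by exists c.
  move=> e /cu[N h]; exists N => m n mN nN.
  apply: le_trans (coef_le_projN_norm2 (fun k => u m k - u n k) admL Lk) _.
  exact: le_trans (normML_ge p1 (uB m n)).2 (ltW (h _ _ mN nN)).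
pose f k := Ld k * v k + (if Lh k == 0 then q k else 0).
(* On the null set every L (u n) vanishes, hence so does its limit v; off it, L inverts Ld. *)
have Lf : app Lh f = v.
  apply/funext => k; rewrite /app /f; case: eqVneq => [Lk|Lk].
    rewrite Lk mul0r; apply: climit_unique (wv k).
    apply: eq_climit (climit_cst 0); exists 0%N => n _.
    by rewrite /app Lk mul0r.
  by rewrite addr0 mulrA pinv_mul1// mul1r.
have fM : in_ML Lh f.
  split; last by rewrite Lf.
  have sq : slowly_growing (fun k => if Lh k == 0 then q k else 0).
    by apply/rapid_slowly_growing/null_supp_rapid => k /negbTE ->.
  have := slowly_growing_lin 1 (slowly_growing_app slowLd vM.1) sq.
  by congr slowly_growing; apply/funext => k; rewrite mul1r.
exists f; split => // e e0.
have [K [K0 projK]] := projN_norm2_le admL.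
(* The measure part and the projection part each get e / 4, leaving room for the strict inequality;
   K + 1 allows K = 0. *)
have e4 : 0 < e / 4 by rewrite divr_gt0.
have K1 : 0 < K + 1 by rewrite ltr_wpDl.
have eK : 0 < e / 4 / (K + 1) by rewrite divr_gt0.
have [N1 h1] := vclose _ e4; have [N2 h2] := cu _ eK.
exists (maxn N1 N2) => n; rewrite geq_max => /andP[nN1 nN2].
have le1 : normM (app Lh (fun k => u n k - f k)) <= e / 4.
  by rewrite appB Lf; exact: h1.
have le2 : projN_norm2 Lh (fun k => u n k - f k) <= e / 4.
  apply: le_trans (projK _ (e / 4 / (K + 1)) (ltW eK) _) _; last first.
    by rewrite mulrCA ler_piMr ?(ltW e4)// ler_pdivrMr// mul1r lerDl.
  move=> k Lk; have fk : f k = q k by rewrite /f Lk eqxx (pinv_null pinvL Lk) mul0r add0r.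
  (* With n fixed, m tends to infinity in the Cauchy estimate at each null frequency. *)
  have un : climit (fun m => u n k + -1 * u m k) (u n k + -1 * q k).
    exact: climitD (climit_cst _) (climitZ (-1) (uq k Lk)).
  rewrite fk -mulN1r; apply: (climit_le un); exists N2 => m mN2.
  rewrite mulN1r.
  apply: le_trans (coef_le_projN_norm2 (fun k => u n k - u m k) admL Lk) _.
  exact: le_trans (normML_ge p1 (uB n m)).2 (ltW (h2 _ _ nN2 mN2)).
apply: le_lt_trans (normML_le_add p1 (in_MLB (uM n) fM)) _.
apply: le_lt_trans (lerD le1 le2) _; lra.
Qed.

End NativeSpace.

Unset Implicit Arguments.

Theorem mainTheorem3 (R : realType) (d : nat) (Lh Ld : fseq R d) (p : \bar R) :
  (0 < d)%N -> spline_admissible Lh -> is_pinv Lh Ld -> (1 <= p)%E ->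
  (* (1) M_L = L^dagger(M) (+) N_L *)
  ((forall f, in_ML Lh f <->
      exists w q, [/\ in_M w, in_null Lh q & f = (fun k => app Ld w k + q k)]) /\
   (forall g, (exists w, in_M w /\ g = app Ld w) -> in_null Lh g -> g = @fzero R d)) /\
  (* (2) M_L is a Banach space for ||.||_{M_L,p} *)
  ((forall (a : R[i]) f g, in_ML Lh f -> in_ML Lh g -> in_ML Lh (fun k => a * f k + g k)) /\
   (forall f, in_ML Lh f -> 0 <= normML p Lh f) /\
   (forall f, in_ML Lh f -> normML p Lh f = 0 -> f = @fzero R d) /\
   (forall (a : R[i]) f, in_ML Lh f ->
      normML p Lh (fun k => a * f k) = cmod a * normML p Lh f) /\
   (forall f g, in_ML Lh f -> in_ML Lh g ->
      normML p Lh (fun k => f k + g k) <= normML p Lh f + normML p Lh g) /\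
   (forall u : nat -> fseq R d, (forall n, in_ML Lh (u n)) ->
      (forall eps : R, 0 < eps -> exists N, forall m n, (N <= m)%N -> (N <= n)%N ->
         normML p Lh (fun k => u m k - u n k) < eps) ->
      exists f, in_ML Lh f /\
        (forall eps : R, 0 < eps -> exists N, forall n, (N <= n)%N ->
           normML p Lh (fun k => u n k - f k) < eps))) /\
  (* (3) the norms ||.||_{M_L,p'}, p' in [1, oo], are all equivalent *)
  (forall p' : \bar R, (1 <= p')%E ->
     exists c C : R, [/\ 0 < c, 0 < C & forall f, in_ML Lh f ->
        c * normML p Lh f <= normML p' Lh f /\ normML p' Lh f <= C * normML p Lh f]) /\
  (* (4) S embeds continuously in M_L *)
  ((forall phi, rapidly_decaying phi -> in_ML Lh phi) /\
   (exists (C : R) (n : nat), forall phi, rapidly_decaying phi ->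
      normML p Lh phi <= C * Sseminorm n phi)) /\
  (* (5) M_L embeds continuously in S' (M_L is a subset of S' by definition) *)
  (forall phi, rapidly_decaying phi -> exists C : R, forall f, in_ML Lh f ->
      exists c, pairing_to f phi c /\ cmod c <= C * normML p Lh f) /\
  (* (6) L : M_L -> M is continuous *)
  (exists C : R, forall f, in_ML Lh f -> normM (app Lh f) <= C * normML p Lh f) /\
  (* (7) periodic L-splines lie in M_L *)
  (forall f, is_Lspline Lh f -> in_ML Lh f).
Proof.
move=> _ admL pinvL p1; split; [|split; [|split; [|split; [|split; [|split]]]]].
- split=> [f|_ [w [_ ->]]]; first exact: in_ML_decomp.
  exact: range_null_trivial.
- split; [|split; [|split; [|split; [|split]]]].
  + by move=> a f g; exact: in_ML_lin.
  + by move=> f; exact: normML_ge0.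
  + by move=> f; exact: (normML_eq0 admL pinvL).
  + by move=> a f; exact: normMLZ.
  + by move=> f g; exact: normMLD.
  + by move=> u; exact: (normML_complete admL pinvL).
(* Both bounds are [normML_equiv], with the exponents exchanged for the lower one. *)
- move=> p' p'1; exists (2^-1), 2; split=> // f fM; split; last exact: normML_equiv.
  by rewrite mulrC ler_pdivrMr// mulrC; exact: normML_equiv.
- split; [exact: rapid_in_ML | exact: normML_Sseminorm].
- by move=> phi; exact: (pairing_normML admL pinvL).
- by exists 1 => f fM; rewrite mul1r; exact: (normML_ge p1 fM).1.
- exact: Lspline_in_ML.
Qed.
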